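(* Let $u_0 \in H^3(\mathbb{R})$ be real-valued and let $T \in (0,\infty]$ be the maximal life span of the corresponding unique strong solution $u \in C([0,T), H^3(\mathbb{R})) \cap C^1([0,T), H^2(\mathbb{R}))$ of the Cauchy problem for the Fornberg-Whitham equation $$ u_t + u u_x + K * u_x = 0, \qquad u|_{t=0} = u_0, $$ where $K(x) = \frac{1}{2} e^{-|x|}$ and the convolution is in the $x$ variable. Then $$ \sup_{0 \leq t < T}\ \sup_{x \in \mathbb{R}} \partial_x u(x,t) < \infty . $$
   Context: $H^s(\mathbb{R})$ denotes the $L^2$-based Sobolev space of real-valued functions; $u(t)$ denotes the function $x \mapsto u(x,t)$. A strong solution on $[0,T)$ with initial value $u_0 \in H^3(\mathbb{R})$ is an element $u \in C([0,T), H^3(\mathbb{R})) \cap C^1([0,T), H^2(\mathbb{R}))$ with $u(0) = u_0$ such that $u'(t) + u(t)\,\partial_x u(t) + K * \partial_x u(t) = 0$ holds as an equation in $H^2(\mathbb{R})$ for $0 < t < T$. Strong solutions on closed intervals $[0,T_1]$ are defined analogously. It is a known fact that for every $u_0 \in H^3(\mathbb{R})$ there is a unique strong solution on $[0,T_1]$ for some $T_1 > 0$. The maximal life span $T$ associated with $u_0$ is the supremum of all $T_1 > 0$ such that a (unique) solution exists in $C([0,T_1], H^3(\mathbb{R})) \cap C^1([0,T_1], H^2(\mathbb{R}))$ with $u(0) = u_0$. *)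

(* Defs.v *)
From mathcomp Require Import all_boot all_order all_algebra.
From mathcomp Require Import all_classical all_reals all_analysis.

Set Implicit Arguments.
Unset Strict Implicit.
Unset Printing Implicit Defensive.

Import Order.TTheory GRing.Theory Num.Theory.
Import numFieldNormedType.Exports.

Local Open Scope classical_set_scope.
Local Open Scope ring_scope.

(* Elements of L^2(R) and H^s(R) are handled through representatives
   f : R -> R, two representatives being identified when they agree
   lebesgue_measure-almost everywhere. *)

Section Sobolev.
Context {R : realType}.
Implicit Types (f g phi : R -> R) (k s : nat).

Definition test_function phi : Prop :=
  (forall n x, derivable phi^`(n)%classic x 1) /\
  compact (closure [set x | phi x != 0]).

Definition is_weak_derivative k f g : Prop :=
  forall phi, test_function phi ->
    \int[lebesgue_measure]_x (f x * phi^`(k)%classic x) =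
    (- 1) ^+ k * \int[lebesgue_measure]_x (g x * phi x).

(* The k-th weak derivative in L^2(R), which is unique almost everywhere;
   the value is junk (zero) if there is none. *)
Definition weak_derivative k f : R -> R :=
  xget (cst 0)
    [set g | g \in Lfun lebesgue_measure 2%:E /\ is_weak_derivative k f g].

Definition sobolev s f : Prop :=
  f \in Lfun lebesgue_measure 2%:E /\
  forall k, (k <= s)%N ->
    exists2 g, g \in Lfun lebesgue_measure 2%:E & is_weak_derivative k f g.

Definition sobolev_norm s f : R :=
  Num.sqrt (\sum_(k < s.+1)
    fine ('N[lebesgue_measure]_2%:E [EFin \o weak_derivative k f])%E ^+ 2).

(* The continuous representative of the class of f; it is unique if it exists,
   and it exists for f in H^s(R) with s >= 1. *)
Definition continuous_representative f : R -> R :=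
  xget f [set g | continuous g /\ {ae lebesgue_measure, forall x, g x = f x}].

Definition convolution f g : R -> R :=
  fun x => \int[lebesgue_measure]_y (f (x - y) * g y).

End Sobolev.

Section FornbergWhitham.
Context {R : realType}.
Implicit Types (I : set R) (s : nat) (u v : R -> R -> R).

(* Curves in H^s(R) are written with the time variable first: u t is the
   function x |-> u(x, t).  Only the values for t in I matter. *)

Definition sobolev_continuous I s u : Prop :=
  forall t, I t -> sobolev s (u t) /\
    sobolev_norm s (u r \- u t) @[r --> within I (nbhs t)] --> (0 : R).

Definition sobolev_derivative I s u v : Prop :=
  forall t, I t ->
    sobolev_norm s (fun x => (r - t)^-1 * (u r x - u t x) - v t x)
      @[r --> within I t^'] --> (0 : R).

Definition FW_kernel (x : R) : R := 2^-1 * expR (- `|x|).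

(* I is meant to be [0, T[ or [0, T1], so that its interior is ]0, T[ resp.
   ]0, T1[; the time derivative v is one-sided at the end points that belong
   to I.  The equation is an identity between classes in H^2(R), that is, it
   holds for almost every x. *)
Definition strong_solution I (u0 : R -> R) u : Prop :=
  [/\ sobolev_continuous I 3 u,
      {ae lebesgue_measure, forall x, u 0 x = u0 x} &
      exists v : R -> R -> R,
        [/\ sobolev_continuous I 2 v,
            sobolev_derivative I 2 u v &
            forall t, I^° t ->
              {ae lebesgue_measure, forall x,
                v t x + u t x * weak_derivative 1 (u t) x +
                convolution FW_kernel (weak_derivative 1 (u t)) x = 0}]].

Definition time_interval (T : \bar R) : set R :=
  [set t | 0 <= t /\ (t%:E < T)%E].

Definition life_span (u0 : R -> R) : \bar R :=
  ereal_sup [set T1%:E | T1 in [set T1 : R |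
    0 < T1 /\ exists u, strong_solution `[0, T1] u0 u]].

End FornbergWhitham.

(* Main.v *)
(* Write U = u(t), W = U_x, E = ||U||^2, and let A and B be the left and right
   exponential averages of U, so that A' = U - A, B' = B - U and, integrating
   by parts, K * W = (B - A) / 2.
   Differentiating the equation in x gives W_t = - W^2 - U W_x + U - (A + B) / 2.
   Let S be the maximum of W over [0, t] x R.  If it is attained at a positive
   time, then W_x = 0 <= W_t there, whence S^2 <= 2 sup |U|.  As the slope of U
   is at most S, a large value of |U| forces a large L^2 norm:
   sup |U|^3 <= 8 S E.  Finally E is conserved, because
   u (u u_x + K * u_x) = (u^3 / 3 + A B / 2)_x.  Thus S is bounded by a constant
   depending only on u(0), which yields a bound that is uniform even if T is
   infinite.
   The pointwise calculus rests on the embedding of H^1(R) into the continuous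
   functions, obtained by testing the weak derivative against primitives of
   differences of two mollifiers and letting these concentrate at Lebesgue
   points. *)

Require Import Defs.
From mathcomp Require Import all_boot all_order all_algebra.
From mathcomp Require Import all_classical all_reals all_analysis.
From mathcomp Require Import measurable_realfun ring lra.
Set Implicit Arguments.
Unset Strict Implicit.
Unset Printing Implicit Defensive.

Import Order.TTheory GRing.Theory Num.Theory.
Import numFieldNormedType.Exports.
Local Open Scope classical_set_scope.
Local Open Scope ring_scope.

(** * Integration toolbox *)

Section RintegralToolbox.
Context {R : realType}.
Notation mu := (@lebesgue_measure R).
Implicit Types (D : set R) (f g h : R -> R).

(** The spatial maximum of the slope need not be differentiable in time, so no differential
    inequality is derived for it. Its maximum over [[0, t]] is only located, which takes continuity
    in time alone (H^3 embeds in C^1), and difference quotients from the left at that single point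
    are compared with the equation. The time derivative exists in H^2, which also embeds in C^1:
    just enough for the quotients of W at a fixed point to converge to the slope of u_t. The
    conserved quantity is an L^2 norm, and W is controlled from above only. This is why the passage
    to sup |U| uses a one-sided slope bound instead of an interpolation with a norm of W. The
    threshold is |U| <= S^2 / 4, which leaves W_t <= - S^2 / 2 < 0 at the maximum; where it fails,
    S^5 <= 512 E. Hence S > 1 + 512 E is impossible at a positive time, and the slopes at time 0 are
    absorbed by adding 2 ||u(0)|| in H^3. *)

Lemma ae_imply (P Q : R -> Prop) : (forall x, P x -> Q x) ->
  {ae mu, forall x, P x} -> {ae mu, forall x, Q x}.
Proof. by move=> PQ; apply: (@filterS _ _ (ae_filter_ringOfSetsType mu)). Qed.

Lemma ae_imply2 (P Q S : R -> Prop) : (forall x, P x -> Q x -> S x) ->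
  {ae mu, forall x, P x} -> {ae mu, forall x, Q x} -> {ae mu, forall x, S x}.
Proof. by move=> PQS; apply: (@filterS2 _ _ (ae_filter_ringOfSetsType mu)). Qed.

Lemma ae_and (P Q : R -> Prop) : {ae mu, forall x, P x} -> {ae mu, forall x, Q x} ->
  {ae mu, forall x, P x /\ Q x}.
Proof. exact: ae_imply2. Qed.

Lemma Rintegral_support D f : (forall x, ~ D x -> f x = 0) ->
  \int[mu]_x f x = \int[mu]_(x in D) f x.
Proof.
move=> f0; rewrite [RHS]Rintegral_mkcond; apply: eq_Rintegral => x _.
by rewrite patchE; case: ifPn => // /negP Dx; apply: f0 => Dx'; apply: Dx; rewrite inE.
Qed.

Lemma integrable_support D f : measurable D -> (forall x, ~ D x -> f x = 0) ->
  mu.-integrable D (EFin \o f) -> mu.-integrable setT (EFin \o f).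
Proof.
move=> mD f0 fi.
have -> : f = f \_ D.
  apply/funext => x; rewrite patchE; case: ifPn => // /negP Dx; apply: f0 => Dx'; apply: Dx.
  by rewrite inE.
by rewrite -restrict_EFin; apply/integrable_restrict => //; rewrite setTI.
Qed.

Lemma integrable_scale D f c : measurable D -> mu.-integrable D (EFin \o f) ->
  mu.-integrable D (EFin \o (fun x => c * f x)).
Proof. move=> mD fi; rewrite (_ : EFin \o _ = (fun x => c%:E * (EFin \o f) x)%E);
  last exact/funext.
exact: integrableZl. Qed.

Lemma integrable_add D f g : measurable D -> mu.-integrable D (EFin \o f) ->
  mu.-integrable D (EFin \o g) -> mu.-integrable D (EFin \o (fun x => f x + g x)).
Proof. move=> mD fi gi; rewrite (_ : EFin \o _ = (EFin \o f) \+ (EFin \o g))%E;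
  last exact/funext.
exact: integrableD. Qed.

Lemma integrable_sub D f g : measurable D -> mu.-integrable D (EFin \o f) ->
  mu.-integrable D (EFin \o g) -> mu.-integrable D (EFin \o (fun x => f x - g x)).
Proof. move=> mD fi gi; rewrite (_ : EFin \o _ = (EFin \o f) \- (EFin \o g))%E;
  last exact/funext.
exact: integrableB. Qed.

Lemma integrable_norm D f : measurable D -> mu.-integrable D (EFin \o f) ->
  mu.-integrable D (EFin \o (fun x => `|f x|)).
Proof. move=> mD fi; rewrite (_ : EFin \o _ = abse \o (EFin \o f)); last exact/funext.
exact: integrable_abse. Qed.

Lemma integrable_le D f g : measurable D -> measurable_fun D f ->
  (forall x, D x -> `|f x| <= g x) -> mu.-integrable D (EFin \o g) ->
  mu.-integrable D (EFin \o f).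
Proof.
move=> mD mf fg; apply: le_integrable => //; first exact/measurable_EFinP.
by move=> x Dx; rewrite /= lee_fin (le_trans (fg x Dx))// ler_norm.
Qed.

Lemma integrable_bounded_mul D f h M : measurable D ->
  mu.-integrable D (EFin \o f) -> measurable_fun D h ->
  (forall x, D x -> `|h x| <= M) ->
  mu.-integrable D (EFin \o (fun x => f x * h x)).
Proof.
move=> mD fi mh hM.
have -> : EFin \o (fun x => f x * h x) = ((EFin \o f) \* (EFin \o h))%E.
  by apply/funext => x /=; rewrite EFinM.
apply: integrableMl => //; exists M; split; first by rewrite num_real.
by move=> N MN x Dx /=; rewrite (le_trans (hM x Dx))// ltW.
Qed.

Lemma cvg_Rintegral D (f_ : nat -> R -> R) f g : measurable D ->
  (forall n, measurable_fun D (f_ n)) -> measurable_fun D f ->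
  {ae mu, forall x, D x -> f_ n x @[n --> \oo] --> f x} ->
  mu.-integrable D (EFin \o g) ->
  (forall n x, D x -> `|f_ n x| <= g x) ->
  \int[mu]_(x in D) f_ n x @[n --> \oo] --> \int[mu]_(x in D) f x.
Proof.
move=> mD mf mfD fn gi fg.
have [|||||fi _ h] := @dominated_convergence _ _ _ mu D mD (fun n => EFin \o f_ n) (EFin \o
  f) (EFin \o g).
- by move=> n; apply/measurable_EFinP; exact: mf.
- by apply/measurable_EFinP; exact: mfD.
- by apply: ae_imply fn => x fx Dx; apply: cvg_EFin; [exact: nearW|exact: fx].
- by [].
- by apply: aeW => x n Dx; rewrite /= lee_fin fg.
apply: fine_cvg; rewrite fineK//; exact: integrable_fin_num.
Qed.

Lemma continuous_integrable_itv f (a b : R) : continuous f ->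
  mu.-integrable `[a, b] (EFin \o f).
Proof.
move=> cf; apply: continuous_compact_integrable; first exact: segment_compact.
exact: continuous_subspaceT.
Qed.

Lemma is_derive_continuous f g : (forall x : R, is_derive x 1 f (g x)) -> continuous f.
Proof.
move=> fg x; apply/differentiable_continuous/derivable1_diffP.
by have [] := fg x.
Qed.

Lemma Rintegral_derive f g (a b : R) : a <= b -> continuous g ->
  (forall x : R, is_derive x 1 f (g x)) ->
  \int[mu]_(x in `[a, b]) g x = f b - f a.
Proof.
move=> + cg fg; rewrite le_eqVlt => /predU1P[->|ab].
  by rewrite set_itv1 Rintegral_set1 subrr.
have cf := is_derive_continuous fg.
rewrite /Rintegral (@continuous_FTC2 _ g f)//.
- exact: continuous_subspaceT.
- split.
  + by move=> x _; have [] := fg x.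
  + by apply: cvg_at_right_filter; exact: cf.
  + by apply: cvg_at_left_filter; exact: cf.
- by move=> x _; rewrite derive1E; have [_ ->] := fg x.
Qed.

Lemma Rintegral_itv_cst (c a b : R) : a <= b -> \int[mu]_(x in `[a, b]) c = c * (b - a).
Proof.
move=> ab.
have d (x : R) : is_derive x 1 (fun x => c * x) (cst c x).
  by have := is_deriveZ c (is_derive_id x 1); rewrite /GRing.scale /= mulr1.
by rewrite (Rintegral_derive ab (@cst_continuous _ _ c) d) mulrBr.
Qed.

Lemma Rintegral_itv_cat f (a b c : R) : a <= b -> b <= c ->
  mu.-integrable `[a, c] (EFin \o f) ->
  \int[mu]_(x in `[a, c]) f x = \int[mu]_(x in `[a, b]) f x + \int[mu]_(x in `[b, c]) f x.
Proof.
move=> ab bc fi.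
have := Rintegral_itvB fi (x := b); rewrite !bnd_simp => /(_ ab bc).
rewrite Rintegral_itv_obnd_cbnd; first by move=> <-; rewrite addrC subrK.
by apply: integrableS fi => //; apply: subset_itv; rewrite bnd_simp.
Qed.

End RintegralToolbox.

(** * Smooth functions *)

Section SmoothBump.
Context {R : realType}.
Implicit Types (s x : R) (k n : nat) (p q : {poly R}).

(** The case [k = 0] is the classical flat function exp(-1/s) extended by 0. The index makes the
    span of the family closed under differentiation. *)
Definition flat_exp k s : R := if 0 < s then s ^- k * expR (- s^-1) else 0.

Lemma flat_exp_gt0 k s : 0 < s -> 0 < flat_exp k s.
Proof. by move=> s0; rewrite /flat_exp s0 mulr_gt0 ?expR_gt0// invr_gt0 exprn_gt0. Qed.

Lemma flat_exp_ge0 k s : 0 <= flat_exp k s.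
Proof. by have [/flat_exp_gt0/ltW//|s0] := ltP 0 s; rewrite /flat_exp ltNge s0. Qed.

Lemma flat_expS k s : flat_exp k s = flat_exp k.+1 s * s.
Proof.
rewrite /flat_exp; case: ifPn => [s0|]; last by rewrite mul0r.
by rewrite exprS; field; rewrite ?gt_eqF// exprn_gt0.
Qed.

(** Flatness at 0: with y = 1/s, the power is beaten because exp y >= y^(k+1) / (k+1)!. *)
Lemma flat_exp_le k s : 0 < s -> flat_exp k s <= k.+1`!%:R * s.
Proof.
move=> s0; rewrite /flat_exp s0 expRN ler_pdivrMr ?expR_gt0//.
have := @expR_ge1Dxn R s^-1 k; rewrite invr_ge0 => /(_ (ltW s0)) h.
have {h} : s^-1 ^+ k.+1 <= k.+1`!%:R * expR s^-1.
  rewrite -ler_pdivrMl ?ltr0n ?fact_gt0// mulrC.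
  by apply: le_trans h; rewrite lerDr.
rewrite exprVn => h.
rewrite (_ : s ^- k = s ^- k.+1 * s); last first.
  by rewrite exprS; field; rewrite ?gt_eqF// exprn_gt0.
by rewrite mulrAC ler_pM2r.
Qed.

Lemma flat_exp_continuous0 k : {for 0, continuous (flat_exp k)}.
Proof.
have E0 : flat_exp k 0 = 0 by rewrite /flat_exp ltxx.
apply/cvgrPdist_le; rewrite E0 => e e0; near=> s.
rewrite sub0r normrN ger0_norm ?flat_exp_ge0//.
have [s0|s0] := leP s 0; first by rewrite /flat_exp ltNge s0 /= ltW.
rewrite (le_trans (flat_exp_le k s0))// mulrC -ler_pdivlMr ?ltr0n ?fact_gt0//.
rewrite -[s](ger0_norm (ltW s0)); near: s.
apply: (@nbhs0_le R R^o); rewrite divr_gt0// ltr0n; exact: fact_gt0.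
Unshelve. all: by end_near. Qed.

Lemma is_derive_flat_exp k s :
  is_derive s 1 (flat_exp k) (flat_exp k.+2 s - k%:R * flat_exp k.+1 s).
Proof.
have [s0|s0|->] := ltgtP s 0.
- have -> : flat_exp k.+2 s - k%:R * flat_exp k.+1 s = 0.
    by rewrite /flat_exp !ltNge (ltW s0) /= mulr0 subr0.
  apply: (near_eq_is_derive (f := cst 0)) => //.
  + by near=> t; rewrite /flat_exp ifF//; apply/negbTE; rewrite -leNgt; apply: ltW;
    near: t; exact: lt_nbhsl.
- apply: (near_eq_is_derive (f := fun t : R => t^-1 ^+ k * expR (- t^-1))) => //.
  + by near=> t; rewrite /flat_exp ifT ?exprVn// -oppr_lt0; near: t; apply: Nlt_nbhsl;
    rewrite oppr_lt0.
  + have s1 := lt0r_neq0 s0.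
    have dV : is_derive s 1 (fun t : R => t^-1) (- s ^- 2).
      by have := is_deriveV s1 (is_derive_id s 1); rewrite /GRing.scale /= mulr1.
    have dE : is_derive s 1 (fun t : R => expR (- t^-1)) (expR (- s^-1) * s ^- 2).
      have := @is_derive1_comp _ expR (- GRing.inv) s _ _ (is_derive_expR (- s^-1))
        (is_deriveN dV).
      by rewrite opprK.
    have := is_deriveM (is_deriveX k dV) dE; rewrite exprfctE => h.
    apply: (is_derive_eq h); rewrite /flat_exp s0 /GRing.scale /=.
    by case: k {h} => [|k]; rewrite ?expr0 ?expr1n ?exprS ?exprVn; field;
      rewrite ?gt_eqF ?exprn_gt0.
- have -> : flat_exp k.+2 0 - k%:R * flat_exp k.+1 0 = 0.
    by rewrite /flat_exp !ltxx mulr0 subr0.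
  (* By [flat_expS] the difference quotient at 0 is [flat_exp k.+1] itself, which is continuous
     there with value 0. *)
  apply/is_derive1_caratheodory; exists (flat_exp k.+1); split.
  + by move=> z; rewrite subr0 -flat_expS /flat_exp ltxx subr0.
  + exact: flat_exp_continuous0.
  + by rewrite /flat_exp ltxx.
Unshelve. all: by end_near. Qed.

(** An explicit tower of derivatives: a closed formula is checked one derivative at a time, without
    unfolding iterated derivatives. *)
Definition smooth (f : R -> R) := exists D : nat -> R -> R,
  D 0%N = f /\ forall n x, is_derive x 1 (D n) (D n.+1 x).

Lemma smooth_derivable f : smooth f -> forall n x, derivable f^`(n)%classic x 1.
Proof.
move=> [D [<- D']] n x.
suff -> : (D 0%N)^`(n)%classic = D n by have [] := D' n x.
elim: n => // n IH; rewrite derive1nS IH; apply/funext => y.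
by rewrite derive1E; have [_ ->] := D' n y.
Qed.

Lemma smooth_is_derive (f : R -> R) g : (forall x, is_derive x 1 f (g x)) -> smooth g ->
  smooth f.
Proof.
move=> fg [D [D0 D']]; exists (fun n => if n is m.+1 then D m else f).
by split => // -[|n] x //=; rewrite D0.
Qed.

Lemma smoothB f g : smooth f -> smooth g -> smooth (f \- g).
Proof.
move=> [D [<- D']] [E [<- E']]; exists (fun n => D n \- E n); split => // n x.
exact: is_deriveB.
Qed.

Lemma smooth_flat_exp p q : smooth (fun x => p.[x] * flat_exp 0 q.[x]).
Proof.
(* A pair [(r, k)] stands for r(x) times [flat_exp k] at q(x). Its derivative involves the indices
   k, k+1 and k+2; [flat_expS] brings all of them to index k+2 at the price of powers of q. *)
pose step (pk : {poly R} * nat) : {poly R} * nat :=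
  (pk.1^`() * q ^+ 2 + pk.1 * q^`() * (1 - pk.2%:R *: q), pk.2.+2)%R.
pose D n x := (iter n step (p, 0%N)).1.[x] * flat_exp (iter n step (p, 0%N)).2 q.[x].
exists D; split => // n x; rewrite /D iterS; case: (iter n step _) => r k /=.
have dq := is_derive_poly q x.
have dr := is_derive_poly r x.
have dE := is_derive_flat_exp k q.[x].
have dc : is_derive x 1 (flat_exp k \o horner q) ((flat_exp k.+2 q.[x] - k%:R * flat_exp
  k.+1 q.[x]) * q^`().[x]).
  exact: is_derive1_comp.
have := is_deriveM dr dc => h.
apply: (is_derive_eq h).
rewrite /GRing.scale /= !(hornerD, hornerM, hornerN, hornerZ, hornerC, horner_exp)
  [flat_exp k _]flat_expS [flat_exp k.+1 _]flat_expS.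
ring.
Qed.

End SmoothBump.

(** * Mollifiers and test functions *)

Section Mollifier.
Context {R : realType}.
Notation mu := (@lebesgue_measure R).
Implicit Types (a h x : R) (f g : R -> R).

(** Supported in [a - h, a + h] and not normalised: the mass is [ustep 1] for every [h > 0], a
    positive factor that is carried along and cancelled at the end. *)
Definition mollifier a h x : R := h^-1 * flat_exp 0 (1 - ((x - a) / h) ^+ 2).

Lemma smooth_mollifier a h : smooth (mollifier a h).
Proof.
have := smooth_flat_exp (h^-1%:P) (1 - (h^-1 *: ('X - a%:P)) ^+ 2).
congr smooth; apply/funext => x.
by rewrite !(hornerD, hornerM, hornerN, hornerZ, hornerC, hornerX, horner_exp) /mollifier
  (mulrC (x - a)).
Qed.

Lemma smooth_continuous f : smooth f -> continuous f.
Proof. by move=> [D [<- D']]; apply: (is_derive_continuous (D' 0%N)). Qed.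

Lemma mollifier_continuous a h : continuous (mollifier a h).
Proof. exact/smooth_continuous/smooth_mollifier. Qed.

Lemma mollifier_ge0 a h x : 0 < h -> 0 <= mollifier a h x.
Proof. by move=> h0; rewrite mulr_ge0 ?flat_exp_ge0// invr_ge0 ltW. Qed.

Lemma mollifier_le a h x : 0 < h -> mollifier a h x <= h^-1.
Proof.
move=> h0; rewrite /mollifier ler_piMr ?invr_ge0 ?(ltW h0)// /flat_exp; case: ifPn => // s0.
rewrite expr0 invr1 mul1r; by apply: ltW; rewrite expR_lt1 oppr_lt0 invr_gt0.
Qed.

Lemma mollifier_norm_le a h x : 0 < h -> `|mollifier a h x| <= h^-1.
Proof. by move=> h0; rewrite ger0_norm ?mollifier_le// mollifier_ge0. Qed.

Lemma mollifier_eq0 a h x : 0 < h -> h <= `|x - a| -> mollifier a h x = 0.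
Proof.
move=> h0 hx; rewrite /mollifier /flat_exp ifF ?mulr0//; apply/negbTE; rewrite -leNgt subr_le0.
rewrite -[X in _ <= X]ger0_norm ?sqr_ge0// normrX exprn_ege1//.
by rewrite normrM normfV (gtr0_norm h0) ler_pdivlMr// mul1r.
Qed.

Lemma mollifier_gt0 x : `|x| < 1 -> 0 < mollifier 0 1 x.
Proof.
move=> x1; rewrite /mollifier subr0 divr1 invr1 mul1r flat_exp_gt0// subr_gt0.
rewrite -[X in X < _]ger0_norm ?sqr_ge0// normrX exprn_ilt1//.
Qed.

Lemma mollifier_scale a h x : mollifier a h x = mollifier 0 1 ((x - a) / h) * h^-1.
Proof. by rewrite /mollifier subr0 divr1 invr1 mul1r mulrC. Qed.

Lemma mollifier_integrable : mu.-integrable setT (EFin \o mollifier 0 1).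
Proof.
have E : mollifier 0 1 = (mollifier 0 1) \_ `[-1, 1].
  apply/funext => x; rewrite patchE; case: ifPn => // /negP; rewrite inE /= in_itv /= => /negP.
  rewrite -ler_norml -ltNge => x1; apply: mollifier_eq0 => //; rewrite subr0; exact: ltW.
rewrite E -restrict_EFin; apply/integrable_restrict => //.
by rewrite setTI; apply: continuous_integrable_itv; exact: mollifier_continuous.
Qed.

Definition ustep x : R := \int[mu]_(t in `]-oo, x]) mollifier 0 1 t.

Lemma is_derive_ustep x : is_derive x 1 ustep (mollifier 0 1 x).
Proof.
have [||||d e] := @continuous_FTC1 R (mollifier 0 1) -oo%O x (x + 1).
- by rewrite ltrDl.
- by apply: integrableS mollifier_integrable.
- by rewrite ltNyr.
- exact: mollifier_continuous.
- by apply: DeriveDef; [exact: d|rewrite -e derive1E].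
Qed.

Lemma ustep_le x y : x <= y -> ustep x <= ustep y.
Proof.
move=> xy; rewrite -subr_ge0 -(Rintegral_derive xy (@mollifier_continuous 0 1) is_derive_ustep).
by apply: Rintegral_ge0 => z _; exact: mollifier_ge0.
Qed.

Lemma ustep_eq0 x : x <= -1 -> ustep x = 0.
Proof.
move=> x1; rewrite /ustep (@eq_Rintegral _ _ _ _ _ (cst 0)); last first.
  move=> t; rewrite inE /= in_itv /= => tx; apply: mollifier_eq0 => //.
  rewrite subr0 ler_normr; apply/orP; right; rewrite lerNr; exact: le_trans x1.
by rewrite Rintegral_cst// mul0r.
Qed.

Lemma ustep_eq1 x : 1 <= x -> ustep x = ustep 1.
Proof.
move=> x1; apply/eqP; rewrite -subr_eq0 -(Rintegral_derive x1 (@mollifier_continuous 0 1)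
  is_derive_ustep).
rewrite (@eq_Rintegral _ _ _ _ _ (cst 0)) ?Rintegral_cst// ?mul0r// => t.
rewrite inE /= in_itv /= => /andP[t1 _]; apply: mollifier_eq0 => //.
by rewrite subr0 ger0_norm// (le_trans _ t1).
Qed.

Lemma ustep1_gt0 : 0 < ustep 1.
Proof.
have [||c cI] := @MVT R ustep (mollifier 0 1) (-1) 1 _ (fun x _ => is_derive_ustep x).
- lra.
- exact/continuous_subspaceT/is_derive_continuous/is_derive_ustep.
rewrite (ustep_eq0 (lexx _)) subr0 => ->.
apply: mulr_gt0; last lra.
by rewrite mollifier_gt0//; move: cI; rewrite in_itv /= ltr_norml.
Qed.

Lemma ustep_ge0 x : 0 <= ustep x.
Proof. by apply: Rintegral_ge0 => z _; exact: mollifier_ge0. Qed.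

Lemma ustep_le1 x : ustep x <= ustep 1.
Proof. by have [x1|/ltW/ustep_eq1->//] := leP x 1; apply: ustep_le. Qed.

(** A smooth Heaviside function at [a], rising from 0 to [ustep 1] across [a - h, a + h]. *)
Definition step a h x : R := ustep ((x - a) / h).

Lemma is_derive_step a h x : is_derive x 1 (step a h) (mollifier a h x).
Proof.
rewrite mollifier_scale.
have d : is_derive x 1 (fun y => (y - a) / h) h^-1.
  have := is_derive_poly ((h^-1 *: ('X - a%:P)) : {poly R}) x.
  rewrite derivZ derivXsubC hornerZ hornerC mulr1.
  by congr (is_derive _ _ _ _); apply/funext => y; rewrite hornerZ hornerXsubC mulrC.
exact: is_derive1_comp (is_derive_ustep _) d.
Qed.

Lemma step_eq0 a h x : 0 < h -> x <= a - h -> step a h x = 0.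
Proof. by move=> h0 xa; apply: ustep_eq0; rewrite ler_pdivrMr//; lra. Qed.

Lemma step_eq1 a h x : 0 < h -> a + h <= x -> step a h x = ustep 1.
Proof. by move=> h0 xa; apply: ustep_eq1; rewrite ler_pdivlMr//; lra. Qed.

Lemma Rintegral_mollifier a h : 0 < h ->
  \int[mu]_(x in `[a - h, a + h]) mollifier a h x = ustep 1.
Proof.
move=> h0; rewrite (Rintegral_derive _ (@mollifier_continuous a h) (@is_derive_step a h));
  last lra.
by rewrite (step_eq0 (x := a - h)) ?lexx// (step_eq1 (x := a + h)) ?lexx// subr0.
Qed.

Lemma test_functionP f b : smooth f -> (forall x, b < `|x| -> f x = 0) -> test_function f.
Proof.
move=> sf f0; split; first exact: smooth_derivable.
apply: (@subclosed_compact _ _ `[- b, b]%classic);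
  [exact: closed_closure|exact: segment_compact|].
have -> : `[- b, b]%classic = closure `[- b, b]%classic.
  by apply/closure_id; exact: interval_closed.
apply: closureS => x /= fx; rewrite in_itv /= -ler_norml leNgt.
by apply: contra fx => /f0 ->.
Qed.

Lemma test_function_mollifier a h : 0 < h -> test_function (mollifier a h).
Proof.
move=> h0; apply: (@test_functionP _ (`|a| + h)); first exact: smooth_mollifier.
move=> x xh; apply: mollifier_eq0 => //.
have := ler_normB x (x - a); rewrite opprB addrC subrK => H.
have := lerB_dist x a; lra.
Qed.

(** Beyond both transition zones the two steps agree, so the support is bounded. For a < b and small
    [h] the difference is a smooth plateau over [a, b]. *)
Lemma test_function_step a b h : 0 < h -> test_function (step a h \- step b h).
Proof.
move=> h0; apply: (@test_functionP _ (`|a| + `|b| + h)).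
  apply: (smooth_is_derive (g := mollifier a h \- mollifier b h)); last by apply: smoothB;
    exact: smooth_mollifier.
  by move=> x; apply: is_deriveB; exact: is_derive_step.
move=> x; have /andP[a1 a2] : - `|a| <= a <= `|a| by rewrite -ler_norml.
have /andP[b1 b2] : - `|b| <= b <= `|b| by rewrite -ler_norml.
have [x0|x0] := leP 0 x; [rewrite (ger0_norm x0) => hx /=|rewrite (ltr0_norm x0) => hx /=].
- by rewrite !step_eq1 ?subrr//; lra.
- by rewrite !step_eq0 ?subrr//; lra.
Qed.

Lemma derive1_step a b h : (step a h \- step b h)^`()%classic = mollifier a h \- mollifier b h.
Proof.
apply/funext => x; rewrite derive1E.
by have [_ ->] := is_deriveB (is_derive_step a h x) (is_derive_step b h x).
Qed.

End Mollifier.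

(** * Weak derivatives *)

Section WeakDerivatives.
Context {R : realType}.
Notation mu := (@lebesgue_measure R).
Implicit Types (a b h x y : R) (f g : R -> R).

Lemma locally_integrable_itv f a b : locally_integrable setT f ->
  mu.-integrable `[a, b] (EFin \o f).
Proof.
move=> [mf _ fi]; apply/integrableP; split.
  by apply/measurable_EFinP; exact: measurable_funTS.
by apply: fi => //; exact: segment_compact.
Qed.

(** The kernel is at most 1/h on a ball of measure 2h, so the error is at most twice the mean of |f
    - f(a)| over that ball; this mean tends to 0 at a Lebesgue point. *)
Lemma mollify_le f a h : 0 < h -> locally_integrable setT f ->
  `|\int[mu]_x (f x * mollifier a h x) - f a * ustep 1| <= 2 * fine (davg f a h).
Proof.
move=> h0 lf; set B := ball a h.
have mB : measurable B by exact: measurable_ball.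
have BI : B `<=` `[a - h, a + h].
  by rewrite /B ball_itv; apply: subset_itv_oo_cc.
have b0 x : ~ B x -> mollifier a h x = 0.
  move=> Bx; apply: mollifier_eq0 => //; rewrite distrC leNgt; exact/negP.
have b0I x : ~ `[a - h, a + h]%classic x -> mollifier a h x = 0.
  by move=> Ix; apply: b0 => /BI.
have fi : mu.-integrable B (EFin \o f).
  by apply: integrableS (locally_integrable_itv (a - h) (a + h) lf).
have bi : mu.-integrable B (EFin \o mollifier a h).
  by apply: integrableS (continuous_integrable_itv (a - h) (a + h) (@mollifier_continuous _
    a h)).
have mb D : measurable_fun D (mollifier a h).
  by apply: measurable_funTS; apply: continuous_measurable_fun; exact: mollifier_continuous.
have ci : mu.-integrable B (EFin \o cst (f a)).
  by apply: integrableS (continuous_integrable_itv (a - h) (a + h) (@cst_continuous _ _ (f a))).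
have gi : mu.-integrable B (EFin \o (fun x => f x - f a)).
  exact: integrable_sub fi ci.
have -> : ustep 1 = \int[mu]_(x in B) mollifier a h x.
  rewrite -(@Rintegral_mollifier R a h h0) -(Rintegral_support b0I).
  exact: Rintegral_support.
rewrite (Rintegral_support (D := B)); last by move=> x /b0 ->; rewrite mulr0.
rewrite -RintegralZl// -RintegralB//; last 2 first.
- by apply: integrable_bounded_mul (fun x _ => mollifier_norm_le a x h0).
- exact: integrable_scale.
under eq_Rintegral do rewrite -mulrBl.
apply: le_trans (le_normr_Rintegral _ _) _ => //.
  by apply: integrable_bounded_mul (fun x _ => mollifier_norm_le a x h0).
have ngi : mu.-integrable B (EFin \o (fun x => `|f x - f a|)).
  exact: integrable_norm.
apply: (@le_trans _ _ (\int[mu]_(x in B) (`|f x - f a| * h^-1))).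
  apply: le_Rintegral => //.
  - apply: integrable_norm => //.
    by apply: integrable_bounded_mul (fun x _ => mollifier_norm_le a x h0).
  - by apply: (integrable_bounded_mul (M := `|h^-1|)) => //.
  - by move=> x _; rewrite normrM ler_wpM2l// mollifier_norm_le.
rewrite RintegralZr//.
have hE : ((h *+ 2)%:E^-1 = (h *+ 2)^-1%:E)%E.
  by rewrite inver ifF//; apply/negbTE; rewrite mulrn_eq0 /= gt_eqF.
rewrite /davg /iavg lebesgue_measure_ball ?(ltW h0)// hE fineM//; last first.
  apply: integrable_fin_num => //; exact: ngi.
rewrite [fine (_^-1)%:E]/=.
rewrite (_ : fine _ = \int[mu]_(x in B) `|f x - f a|)//.
set I := Rintegral _ _ _; rewrite le_eqVlt; apply/orP; left; apply/eqP.
by rewrite -mulr_natr; field; rewrite gt_eqF.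
Qed.

Lemma mollify f a : locally_integrable setT f -> lebesgue_pt f a ->
  \int[mu]_x (f x * mollifier a n.+1%:R^-1 x) @[n --> \oo] --> f a * ustep 1.
Proof.
move=> lf la.
have h : 2 * fine (davg f a n.+1%:R^-1) @[n --> \oo] --> 2 * (0 : R).
  apply: cvgMl_tmp => //; apply: fine_cvg.
  have h0 : n.+1%:R^-1 @[n --> \oo] --> (0 : R)^'+.
    move=> P aP.
    have H : \forall n \near \oo, (0 < n.+1%:R^-1 :> R) -> P n.+1%:R^-1 := cvg_harmonic aP.
    by apply: filterS H => n; apply; rewrite invr_gt0.
  exact: cvg_comp h0 la.
apply/subr_cvg0/norm_cvg0P; rewrite mulr0 in h.
apply: (squeeze_cvgr _ (cvg_cst 0) h); near=> n.
by rewrite normr_ge0 mollify_le.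
Unshelve. all: by end_near. Qed.

Lemma ae_itv_ex (P : R -> Prop) a b : a < b -> {ae mu, forall x, P x} ->
  exists2 x, `[a, b]%classic x & P x.
Proof.
move=> ab aeP; apply: contrapT => nP.
have : mu.-negligible `[a, b]%classic.
  by apply: negligibleS aeP => x ax /= Px; apply: nP; exists x.
rewrite negligibleP => [H|]; last exact: measurable_itv.
have M : lebesgue_measure `[a, b]%classic = (b - a)%:E.
  by rewrite lebesgue_measure_itv /= lte_fin ab.
by move: (etrans (esym M) H) => -[]/eqP; rewrite subr_eq0 gt_eqF.
Qed.

Lemma ae_eq_continuous f g : continuous f -> continuous g ->
  {ae mu, forall x, f x = g x} -> f = g.
Proof.
move=> cf cg fg; apply/funext => x; apply/eqP; rewrite -subr_eq0; apply: contraT => fgx.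
have c : continuous (f \- g) by move=> y; apply: cvgB; [exact: cf|exact: cg].
have [e /= e0 he] : \forall y \near x, f y - g y != 0.
  exact: (cvgr_neq0 _ (c x) fgx).
have [|y yx yE] := @ae_itv_ex _ x (x + e / 2) _ fg; first by lra.
have : f y - g y != 0.
  apply: he; rewrite /ball_ /= distrC; move: yx; rewrite /= in_itv /= => /andP[? ?].
  rewrite ger0_norm; lra.
by rewrite yE subrr eqxx.
Qed.

Definition is_L2 f := f \in Lfun mu 2%:E.

Lemma L2_measurable f : is_L2 f -> measurable_fun setT f.
Proof. by rewrite /is_L2 inE => /andP[/[!inE]/=]. Qed.

Lemma L2_mul_integrable f g : is_L2 f -> is_L2 g ->
  mu.-integrable setT (EFin \o (fun x => f x * g x)).
Proof. by move=> Lf Lg; apply/Lfun1_integrable; exact: Lfun2_mul_Lfun1. Qed.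

Lemma L2_locally_integrable f : is_L2 f -> locally_integrable setT f.
Proof.
move=> Lf; have mf := L2_measurable Lf; split => //; first exact: openT.
move=> K _ cK.
have mK := compact_measurable cK.
have fi : mu.-integrable K (EFin \o (fun x => f x * f x)).
  by apply: integrableS (L2_mul_integrable Lf Lf).
have ci : mu.-integrable K (EFin \o cst 1).
  by apply: continuous_compact_integrable => //; apply: continuous_subspaceT;
    exact: cst_continuous.
have /integrableP[] : mu.-integrable K (EFin \o f); last by [].
(* The majorant is |f| <= f^2 + 1, integrable because [K] is compact. *)
apply: (integrable_le mK _ _ (integrable_add mK fi ci)).
  exact: measurable_funTS.
move=> x _; rewrite ler_norml /=; apply/andP; split; nra.
Qed.

(** At a common Lebesgue point, mollifiers centred there recover the values of [f] and [g] from the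
    same integrals. *)
Lemma fundamental_lemma f g : locally_integrable setT f -> locally_integrable setT g ->
  is_weak_derivative 0 f g -> {ae mu, forall x, f x = g x}.
Proof.
move=> lf lg fg.
apply: ae_imply2 (lebesgue_differentiation lf) (lebesgue_differentiation lg) => x fx gx.
have k0 := @ustep1_gt0 R.
apply: (mulIf (lt0r_neq0 k0)).
apply: (norm_cvg_unique (mollify lf fx)).
suff /= -> : (fun n => \int[mu]_t (f t * mollifier x n.+1%:R^-1 t)) =
    (fun n => \int[mu]_t (g t * mollifier x n.+1%:R^-1 t)) by exact: mollify.
apply/funext => n.
have /fg := @test_function_mollifier R x n.+1%:R^-1 (ltac:(by rewrite invr_gt0)).
by rewrite expr0 mul1r derive1n0.
Qed.

Lemma ae_neq a : {ae mu, forall x, x != a}.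
Proof.
exists [set a]; split => //; first exact: lebesgue_measure_set1.
by move=> x /= /negP; rewrite negbK => /eqP.
Qed.

Lemma step_norm_le a b h x : `|step a h x - step b h x| <= ustep 1.
Proof.
have := ustep_ge0 ((x - a) / h); have := ustep_ge0 ((x - b) / h).
have := ustep_le1 ((x - a) / h); have := ustep_le1 ((x - b) / h).
by rewrite /step ler_norml; move=> *; apply/andP; split; lra.
Qed.

(** Dominated convergence: away from the two end points, which form a null set, the plateau is
    eventually [ustep 1] inside [x, y] and 0 outside. *)
Lemma cvg_Rintegral_step g x y : x < y -> locally_integrable setT g ->
  \int[mu]_t (g t * (step x n.+1%:R^-1 t - step y n.+1%:R^-1 t)) @[n --> \oo] -->
  ustep 1 * \int[mu]_(t in `[x, y]) g t.
Proof.
move=> xy lg; set D := `[x - 1, y + 1]%classic.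
have mD : measurable (D : set (measurableTypeR R)) by exact: measurable_itv.
have gi := locally_integrable_itv (x - 1) (y + 1) lg.
have DE n : \int[mu]_t (g t * (step x n.+1%:R^-1 t - step y n.+1%:R^-1 t)) =
   \int[mu]_(t in D) (g t * (step x n.+1%:R^-1 t - step y n.+1%:R^-1 t)).
  apply: Rintegral_support => t; rewrite /D /= in_itv /= => /negP; rewrite negb_and -!ltNge.
  have n0 : 0 < n.+1%:R^-1 :> R by rewrite invr_gt0.
  have n1 : n.+1%:R^-1 <= 1 :> R by rewrite invf_le1// ler1n.
  move: (n.+1%:R^-1) n0 n1 => h n0 n1.
  by move=> /orP[tx|ty]; [rewrite !step_eq0|rewrite !step_eq1]; rewrite ?subrr ?mulr0//; lra.
rewrite (funext DE).
have xyD : `[x, y] `<=` D by apply: subset_itv; rewrite bnd_simp; lra.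
have -> : ustep 1 * \int[mu]_(t in `[x, y]) g t = \int[mu]_(t in D) (g \_ `[x, y] t * ustep 1).
  rewrite RintegralZr//; last first.
    rewrite -restrict_EFin; apply/integrable_restrict;
      [exact: measurable_itv|exact: measurable_itv|].
    by rewrite setIidr//; exact: locally_integrable_itv.
  rewrite mulrC; congr (_ * _).
  by rewrite -Rintegral_mkcondr setIidr.
have [mg _ _] := lg.
have mst n : measurable_fun D (fun t => step x n.+1%:R^-1 t - step y n.+1%:R^-1 t :> R).
  by apply: measurable_funB; apply: measurable_funTS; apply: continuous_measurable_fun;
    exact: (is_derive_continuous (@is_derive_step R _ _)).
apply: (@cvg_Rintegral _ D _ _ (fun t => `|g t| * ustep 1)) => //.
- by move=> n; apply: measurable_funM; [exact: measurable_funTS|exact: mst].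
- apply: measurable_funM => //; apply: measurable_funTS.
  by apply/(measurable_restrictT _ _).1; [exact: measurable_itv|exact: measurable_funTS].
- apply: ae_imply2 (ae_neq x) (ae_neq y) => t tx ty _.
  rewrite patchE; case: ifPn => [|/negP]; rewrite inE /= in_itv /=.
  + move=> /andP[xt ty']; apply: cvgM; first exact: cvg_cst.
    have xt0 : 0 < t - x by rewrite subr_gt0 lt_neqAle eq_sym tx.
    have ty0 : 0 < y - t by rewrite subr_gt0 lt_neqAle ty.
    apply: cvg_near_cst; near=> n.
    have n0 : 0 < n.+1%:R^-1 :> R by rewrite invr_gt0.
    have n1 : n.+1%:R^-1 < t - x by near: n; exact: (near_infty_natSinv_lt (PosNum xt0)).
    have n2 : n.+1%:R^-1 < y - t by near: n; exact: (near_infty_natSinv_lt (PosNum ty0)).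
    move: (n.+1%:R^-1) n0 n1 n2 => h n0 n1 n2.
    rewrite (step_eq1 (a := x))//; last lra.
    by rewrite (step_eq0 (a := y)) ?subr0//; lra.
  + move=> /negP; rewrite negb_and -!ltNge => h.
    (* Outside its set a restricted function takes the default value [point], which is 0 in [R]. *)
    have -> : (point : R) * ustep 1 = g t * 0 by rewrite mulr0; exact: mul0r.
    apply: cvgM; first exact: cvg_cst.
    case/orP : h => h.
    * have h0 : 0 < x - t by rewrite subr_gt0.
      apply: cvg_near_cst; near=> n.
      have n0 : 0 < n.+1%:R^-1 :> R by rewrite invr_gt0.
      have n1 : n.+1%:R^-1 < x - t by near: n; exact: (near_infty_natSinv_lt (PosNum h0)).
      by move: (n.+1%:R^-1) n0 n1 => h' n0 n1; rewrite !step_eq0 ?subrr//; lra.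
    * have h0 : 0 < t - y by rewrite subr_gt0.
      apply: cvg_near_cst; near=> n.
      have n0 : 0 < n.+1%:R^-1 :> R by rewrite invr_gt0.
      have n1 : n.+1%:R^-1 < t - y by near: n; exact: (near_infty_natSinv_lt (PosNum h0)).
      by move: (n.+1%:R^-1) n0 n1 => h' n0 n1; rewrite !step_eq1 ?subrr//; lra.
- by apply: (integrable_bounded_mul (M := `|ustep 1|)) => //; exact: integrable_norm.
- by move=> n t _; rewrite normrM ler_wpM2l// step_norm_le.
Unshelve. all: by end_near. Qed.

(** The test function is the plateau over [x, y], whose derivative is a mollifier at [x] minus one
    at [y]. Up to sign, one side of the weak identity tends to the increment of [f] and the other to
    the integral of [g], both times [ustep 1]. *)
Lemma weak_derivative_increment f g x y :
  locally_integrable setT f -> locally_integrable setT g -> is_weak_derivative 1 f g ->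
  lebesgue_pt f x -> lebesgue_pt f y -> x < y ->
  f y - f x = \int[mu]_(t in `[x, y]) g t.
Proof.
move=> lf lg fg fx fy xy.
have k0 := @ustep1_gt0 R.
apply: (mulfI (lt0r_neq0 k0)).
have c1 := cvg_Rintegral_step xy lg.
have c2 : \int[mu]_t (f t * mollifier y n.+1%:R^-1 t) - \int[mu]_t (f t * mollifier x
  n.+1%:R^-1 t)
    @[n --> \oo] --> ustep 1 * (f y - f x).
  by rewrite mulrC mulrBl; apply: cvgB; exact: mollify.
apply: (norm_cvg_unique c2).
apply: cvg_trans c1; apply: near_eq_cvg; near=> n.
have n0 : 0 < n.+1%:R^-1 :> R by rewrite invr_gt0.
have := fg _ (test_function_step x y n0).
rewrite derive1n1 derive1_step expr1 mulN1r => /(congr1 -%R); rewrite opprK => <-.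
have mi a : mu.-integrable setT (EFin \o (fun t => f t * mollifier a n.+1%:R^-1 t)).
  apply: (@integrable_support _ `[a - n.+1%:R^-1, a + n.+1%:R^-1]) => //.
    move=> t /= at0; rewrite mollifier_eq0 ?mulr0// leNgt; apply/negP => ta; apply: at0.
    by rewrite in_itv /= -ler_distl ltW.
  apply: integrable_bounded_mul (fun t _ => mollifier_norm_le a t n0) => //.
    exact: locally_integrable_itv.
  by apply: measurable_funTS; apply: continuous_measurable_fun; exact: mollifier_continuous.
rewrite -opprB; congr (- _).
rewrite -RintegralB//.
by apply: eq_Rintegral => t _; rewrite -mulrBr.
Unshelve. all: by end_near. Qed.

End WeakDerivatives.

(** * Square integrable functions *)

Section L2.
Context {R : realType}.
Notation mu := (@lebesgue_measure R).
Implicit Types (a b c h x y : R) (f g : R -> R).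

Lemma Lnorm2E f : ('N[mu]_2%:E[EFin \o f] `^ 2 = \int[mu]_x (f x * f x)%:E)%E.
Proof.
rewrite powR_Lnorm//; apply: eq_integral => x _.
by rewrite /= powR_mulrn// -normrX ger0_norm ?sqr_ge0.
Qed.

Lemma L2P f : is_L2 f <->
  measurable_fun setT f /\ mu.-integrable setT (EFin \o (fun x => f x * f x)).
Proof.
split=> [Lf|[mf fi]]; first by split; [exact: L2_measurable|exact: L2_mul_integrable].
rewrite /is_L2 inE; apply/andP; split; rewrite inE//=.
rewrite /finite_norm; apply: (@lty_poweRy _ _ 2) => //.
by rewrite Lnorm2E; have /fin_numPlt/andP[] := integrable_fin_num measurableT fi.
Qed.

Definition sqnorm f : R := \int[mu]_x (f x * f x).

Lemma sqnorm_ge0 f : 0 <= sqnorm f.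
Proof. by apply: Rintegral_ge0 => x _; rewrite -expr2 sqr_ge0. Qed.

Lemma sqnormE f : is_L2 f -> fine ('N[mu]_2%:E[EFin \o f])%E ^+ 2 = sqnorm f.
Proof.
move=> Lf; rewrite /sqnorm /Rintegral -Lnorm2E.
have : ('N[mu]_2%:E[EFin \o f] < +oo)%E by move: Lf; rewrite /is_L2 inE => /andP[_];
  rewrite inE.
move/ge0_fin_numE : (Lnorm_ge0 mu 2%:E (EFin \o f)) => <- /fineK <-.
by rewrite poweR_EFin /= powR_mulrn// fine_ge0// Lnorm_ge0.
Qed.

Lemma L2_scale c f : is_L2 f -> is_L2 (fun x => c * f x).
Proof.
move=> /L2P[mf fi]; apply/L2P; split; first exact: measurable_funM.
have := integrable_scale (c * c) measurableT fi.
by congr (mu.-integrable _ (_ \o _)); apply/funext => x; ring.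
Qed.

Lemma L2_add f g : is_L2 f -> is_L2 g -> is_L2 (fun x => f x + g x).
Proof.
move=> /L2P[mf fi] /L2P[mg gi]; apply/L2P; split; first exact: measurable_funD.
apply: (integrable_le (g := fun x => 2 * (f x * f x) + 2 * (g x * g x))) => //.
- by apply: measurable_funM; exact: measurable_funD.
- move=> x _; rewrite -!expr2 ger0_norm ?sqr_ge0//.
  have := sqr_ge0 (f x - g x); nra.
- by apply: integrable_add => //; exact: integrable_scale.
Qed.

Lemma L2_sub f g : is_L2 f -> is_L2 g -> is_L2 (fun x => f x - g x).
Proof.
move=> Lf Lg; have := L2_add Lf (L2_scale (-1) Lg).
by congr is_L2; apply/funext => x; rewrite mulN1r.
Qed.

Lemma eq_ae_Rintegral D f g : measurable D -> measurable_fun D f -> measurable_fun D g ->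
  {ae mu, forall x, f x = g x} -> \int[mu]_(x in D) f x = \int[mu]_(x in D) g x.
Proof.
move=> mD mf mg fg; congr fine; apply: ae_eq_integral => //; try exact/measurable_EFinP.
by apply: ae_imply fg => x ->.
Qed.

Lemma eq_ae_integrable D f g : measurable D -> measurable_fun D f ->
  {ae mu, forall x, f x = g x} -> mu.-integrable D (EFin \o g) -> mu.-integrable D (EFin \o f).
Proof.
move=> mD mf fg gi; have /integrableP[mg gfin] := gi.
apply/integrableP; split; first exact/measurable_EFinP.
rewrite (le_lt_trans _ gfin)// le_eqVlt; apply/orP; left; apply/eqP.
apply: ae_eq_integral => //; try by apply: measurableT_comp => //; exact/measurable_EFinP.
by apply: ae_imply fg => x /= ->.
Qed.

Lemma eq_ae_L2 f g : measurable_fun setT f -> {ae mu, forall x, f x = g x} -> is_L2 g ->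
  is_L2 f.
Proof.
move=> mf fg /L2P[mg gi]; apply/L2P; split => //.
apply: (eq_ae_integrable _ _ _ gi) => //; first exact: measurable_funM.
by apply: ae_imply fg => x ->.
Qed.

Lemma eq_ae_sqnorm f g : is_L2 f -> is_L2 g -> {ae mu, forall x, f x = g x} ->
  sqnorm f = sqnorm g.
Proof.
move=> /L2P[mf _] /L2P[mg _] fg; apply: eq_ae_Rintegral => //; try exact: measurable_funM.
by apply: ae_imply fg => x ->.
Qed.

Lemma Rintegral_le_setT D f : measurable D -> (forall x, 0 <= f x) ->
  mu.-integrable setT (EFin \o f) -> \int[mu]_(x in D) f x <= \int[mu]_x f x.
Proof.
move=> mD f0 fi; rewrite Rintegral_mkcond; apply: le_Rintegral => //.
- rewrite -restrict_EFin; apply/integrable_restrict => //; rewrite setTI.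
  by apply: integrableS fi.
- by move=> x _; rewrite patchE; case: ifPn.
Qed.

Lemma cauchy_schwarz f g : is_L2 f -> is_L2 g ->
  (\int[mu]_x (f x * g x)) ^+ 2 <= sqnorm f * sqnorm g.
Proof.
move=> Lf Lg; set I := Rintegral _ _ _.
have fi := L2_mul_integrable Lf Lf; have gi := L2_mul_integrable Lg Lg.
have fgi := L2_mul_integrable Lf Lg.
have H c : 0 <= sqnorm f - 2 * c * I + c ^+ 2 * sqnorm g.
  apply: le_trans (sqnorm_ge0 (fun x => f x - c * g x)) _; rewrite /sqnorm le_eqVlt;
    apply/orP; left; apply/eqP.
  have i1 := integrable_scale (2 * c) measurableT fgi.
  have i2 := integrable_scale (c ^+ 2) measurableT gi.
  rewrite -(RintegralZl (2 * c) measurableT fgi) -(RintegralZl (c ^+ 2) measurableT gi).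
  rewrite -RintegralB// -RintegralD//; last exact: integrable_sub.
  by apply: eq_Rintegral => x _; ring.
have [g0|g0] := eqVneq (sqnorm g) 0.
  rewrite g0 mulr0.
  have [->|I0] := eqVneq I 0; first by rewrite expr0n.
  (* With [sqnorm g = 0] the form is affine in [c], and this choice would give it the value -1. *)
  have := H ((sqnorm f + 1) / (2 * I)); rewrite g0 mulr0 addr0.
  have -> : 2 * ((sqnorm f + 1) / (2 * I)) * I = sqnorm f + 1 by field.
  lra.
have gp : 0 < sqnorm g by rewrite lt_neqAle eq_sym g0 sqnorm_ge0.
(* The minimiser of the quadratic in [c]. *)
have := H (I / sqnorm g).
have -> : sqnorm f - 2 * (I / sqnorm g) * I + (I / sqnorm g) ^+ 2 * sqnorm g =
  sqnorm f - I ^+ 2 / sqnorm g.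
  by field.
by rewrite subr_ge0 ler_pdivrMr.
Qed.

Lemma sqr_Rintegral_itv_le g x y : x <= y -> is_L2 g ->
  (\int[mu]_(t in `[x, y]) g t) ^+ 2 <= (y - x) * \int[mu]_(t in `[x, y]) (g t * g t).
Proof.
move=> xy Lg; set I := `[x, y]%classic.
have mI : measurable (I : set (measurableTypeR R)) by exact: measurable_itv.
have [mg gi] := (L2P _).1 Lg.
have m1 : measurable_fun setT (\1_I : R -> R) by exact: measurable_indic.
have E f : \int[mu]_(t in I) f t = \int[mu]_t (\1_I t * f t).
  rewrite Rintegral_mkcond; apply: eq_Rintegral => t _.
  by rewrite patchE indicE; case: ifP => _; rewrite ?mul1r ?mul0r.
have L1 : is_L2 (\1_I : R -> R).
  apply/L2P; split => //.
  apply: (@integrable_support _ I) => //.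
    by move=> t It; rewrite indicE memNset// mul0r.
  apply: (integrable_le (g := cst 1)) => //.
  - by apply: measurable_funM; exact: measurable_funTS.
  - by move=> t _; rewrite indicE; case: (_ \in _); rewrite ?mulr1 ?mulr0 ?normr1 ?normr0.
  - by apply: continuous_integrable_itv; exact: cst_continuous.
have L2 : is_L2 (fun t => \1_I t * g t).
  apply/L2P; split; first exact: measurable_funM.
  apply: integrable_le gi => //.
    by apply: measurable_funM; exact: measurable_funM.
  move=> t _; rewrite indicE; case: (_ \in _);
    rewrite ?mul1r ?mul0r ?normr0 -expr2 ?ger0_norm ?sqr_ge0//.
have := cauchy_schwarz L1 L2.
have -> : sqnorm (\1_I : R -> R) = y - x.
  have -> : sqnorm (\1_I : R -> R) = \int[mu]_(t in I) 1.
    rewrite E; apply: eq_Rintegral => t _; rewrite indicE; case: (_ \in _);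
      rewrite ?mulr1 ?mulr0//.
  by rewrite Rintegral_itv_cst// mul1r.
rewrite !E /sqnorm.
have -> : \int[mu]_t (\1_I t * (\1_I t * g t)) = \int[mu]_t (\1_I t * g t).
  by apply: eq_Rintegral => t _; rewrite indicE; case: (_ \in _); rewrite ?mul1r ?mul0r.
have -> // : \int[mu]_t (\1_I t * g t * (\1_I t * g t)) = \int[mu]_t (\1_I t * (g t * g t)).
by apply: eq_Rintegral => t _; rewrite indicE; case: (_ \in _); rewrite ?mul1r ?mul0r.
Qed.

Lemma Rintegral_tail_cvg0 f : mu.-integrable setT (EFin \o f) -> (forall x, 0 <= f x) ->
  forall e : R, 0 < e -> exists2 M : R, 0 < M & forall a b, (M <= a) || (b <= - M) ->
    \int[mu]_(t in `[a, b]) f t <= e.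
Proof.
move=> fi f0 e e0.
have /integrableP[/measurable_EFinP mf _] := fi.
pose A n : set R := ~` `]- n%:R, n%:R[%classic.
have mA n : measurable (A n : set (measurableTypeR R)) by apply: measurableC;
  exact: measurable_itv.
have mi n : measurable_fun setT (fun t => f t * \1_(A n) t : R).
  by apply: measurable_funM; [exact: mf|apply: measurable_indic; exact: mA].
have c : \int[mu]_t (f t * \1_(A n) t) @[n --> \oo] --> \int[mu]_t (0 : R).
  apply: (@cvg_Rintegral _ _ _ _ f) => //.
  - apply: aeW => t _; apply: cvg_near_cst; near=> n.
    rewrite indicE memNset ?mulr0// /A /= => h; apply: h; rewrite in_itv /= -ltr_norml.
    near: n; exact: nbhs_infty_gtr.
  - by move=> n t _; rewrite indicE; case: (_ \in _); rewrite ?mulr1 ?mulr0 ?normr0// ger0_norm.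
rewrite (_ : \int[mu]_t (0 : R) = 0) in c; last by rewrite Rintegral_cst// mul0r.
have [N _ HN] : \forall n \near \oo, \int[mu]_t (f t * \1_(A n) t) <= e.
  by apply: (cvgr_le _ c).
(* The successor keeps the radius positive, as [N] may be 0. *)
exists N.+1%:R => // a b ab.
apply: le_trans (HN N.+1 (leqnSn _)).
rewrite Rintegral_mkcond; apply: le_Rintegral => //.
- rewrite -restrict_EFin; apply/integrable_restrict => //; rewrite setTI.
  by apply: integrableS fi.
- apply: integrable_le fi => // t _.
  by rewrite indicE; case: (_ \in _); rewrite ?mulr1 ?mulr0 ?normr0// ger0_norm.
- move=> t _; rewrite patchE indicE; case: ifPn => [|_]; last by rewrite mulr_ge0.
  rewrite inE /= in_itv /= => /andP[at1 tb]; rewrite mem_set ?mulr1// /A /= in_itv /=.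
  by move=> /andP[t1 t2]; case/orP : ab; lra.
Unshelve. all: by end_near. Qed.

End L2.

(** * Sobolev functions on the line *)

Section Sobolev1.
Context {R : realType}.
Notation mu := (@lebesgue_measure R).
Implicit Types (a b c h x y : R) (f g F G : R -> R).

(** Absolute continuity in integrated form: [g] is in general only square integrable, so it need not
    be the derivative of [F] at a given point. *)
Definition primitive F g := forall x y, x <= y -> F y - F x = \int[mu]_(t in `[x, y]) g t.

(** Cauchy-Schwarz on the interval between the two points; this is Hoelder continuity of exponent
    1/2. *)
Lemma primitive_le F g x y : is_L2 g -> primitive F g ->
  (F y - F x) ^+ 2 <= `|y - x| * sqnorm g.
Proof.
move=> Lg Fg; wlog xy : x y / x <= y.
  have [xy|/ltW yx] := leP x y; first exact.
  by rewrite -sqrrN opprB distrC; apply.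
rewrite ger0_norm ?subr_ge0// Fg// (le_trans (sqr_Rintegral_itv_le xy Lg))//.
rewrite ler_wpM2l ?subr_ge0// Rintegral_le_setT//; last exact: L2_mul_integrable.
by move=> t; rewrite -expr2 sqr_ge0.
Qed.

Lemma primitive_continuous F g : is_L2 g -> primitive F g -> continuous F.
Proof.
move=> Lg Fg x; apply/cvgrPdist_le => e e0.
have S0 : 0 < sqnorm g + 1 by have := sqnorm_ge0 g; lra.
near=> y.
have xy : `|y - x| <= e ^+ 2 / (sqnorm g + 1).
  rewrite distrC; near: y; apply: cvgr_dist_le; first exact: cvg_id.
  by rewrite divr_gt0// exprn_gt0.
rewrite -(ler_pXn2r (n := 2)) ?nnegrE ?(ltW e0)// -normrX ger0_norm ?sqr_ge0//.
rewrite -sqrrN opprB (le_trans (primitive_le _ _ Lg Fg))//.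
apply: (@le_trans _ _ (`|y - x| * (sqnorm g + 1))); first by rewrite ler_wpM2l//; lra.
by rewrite -ler_pdivlMr.
Unshelve. all: by end_near. Qed.

Lemma primitive_is_derive F G x : continuous G -> primitive F G -> is_derive x 1 F (G x).
Proof.
move=> cG FG; set a := x - 1.
have [||||d e] := @continuous_FTC1_closed R G a x (x + 1).
- by rewrite ltrDl.
- exact: continuous_integrable_itv.
- by rewrite /a; lra.
- exact: cG.
have dI : is_derive x 1 (fun y => \int[mu]_(t in `[a, y]) G t) (G x).
  by apply: DeriveDef; [exact: d|rewrite -e derive1E].
have dI' : is_derive x 1 (fun y => F a + \int[mu]_(t in `[a, y]) G t) (G x).
  have := is_deriveD (is_derive_cst (F a) x 1) dI.
  by rewrite add0r.
apply: near_eq_is_derive dI'; near=> y.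
rewrite -FG; first by rewrite addrC subrK.
rewrite /a -subr_ge0 opprB addrA; apply: ltW; rewrite addrC -ltrBlDr sub0r.
rewrite opprD ltrBlDr; near: y; apply: Nlt_nbhsl; lra.
Unshelve. all: by end_near. Qed.

Lemma primitive_ex g x0 c : (forall a b, mu.-integrable `[a, b] (EFin \o g)) ->
  exists2 F, primitive F g & F x0 = c.
Proof.
move=> gi.
(* Integrals over intervals are not oriented, hence the two branches. *)
exists (fun x => if x0 <= x then c + \int[mu]_(t in `[x0, x]) g t
                 else c - \int[mu]_(t in `[x, x0]) g t).
  move=> x y xy; case: ifPn => [x0y|]; case: ifPn => [x0x|].
  - by rewrite (Rintegral_itv_cat (b := x))//; ring.
  - by rewrite -ltNge => /ltW x0x; rewrite [RHS](Rintegral_itv_cat (b := x0))//; ring.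
  - by rewrite (le_trans x0x xy).
  - by rewrite -!ltNge => /ltW x0x /ltW yx0; rewrite (@Rintegral_itv_cat _ g x y)//; ring.
by rewrite lexx set_itv1 Rintegral_set1 addr0.
Qed.

Lemma sobolev_embedding f g : is_L2 f -> is_L2 g -> is_weak_derivative 1 f g ->
  exists F, [/\ {ae mu, forall x, F x = f x}, is_L2 F & primitive F g].
Proof.
move=> Lf Lg fg.
have lf := L2_locally_integrable Lf; have lg := L2_locally_integrable Lg.
have aef := lebesgue_differentiation lf.
(* [F] is normalised at one Lebesgue point of [f]; the increment formula then forces F = f at all
   other Lebesgue points. *)
have [x0 _ fx0] := ae_itv_ex ltr01 aef.
have [F Fg Fx0] := primitive_ex x0 (f x0) (fun a b => locally_integrable_itv a b lg).
have Ff : {ae mu, forall x, F x = f x}.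
  apply: ae_imply aef => x fx.
  have [xx0|xx0|->//] := ltgtP x x0.
  - have := weak_derivative_increment lf lg fg fx fx0 xx0.
    by rewrite -Fg ?(ltW xx0)// Fx0 => /addrI/oppr_inj.
  - have := weak_derivative_increment lf lg fg fx0 fx xx0.
    by rewrite -Fg ?(ltW xx0)// Fx0 => /addIr.
exists F; split => //; apply: eq_ae_L2 Ff Lf.
by apply: continuous_measurable_fun; exact: primitive_continuous Lg Fg.
Qed.

(** The inequality F(x)^2 <= 2 F(t)^2 + 2 (F(t) - F(x))^2 is averaged over t in [x, x + 1]. Keeping
    the right-hand side local gives both the sup bound and the decay at infinity. *)
Lemma primitive_sqr_le F g x : is_L2 F -> is_L2 g -> primitive F g ->
  F x ^+ 2 <= 2 * \int[mu]_(t in `[x, x + 1]) (F t * F t) +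
              2 * \int[mu]_(t in `[x, x + 1]) (g t * g t).
Proof.
move=> LF Lg Fg; set J := \int[mu]_(t in `[x, x + 1]) (g t * g t).
have x1 : x <= x + 1 by rewrite lerDl.
have Fi : mu.-integrable `[x, x + 1] (EFin \o (fun t => F t * F t)).
  by apply: integrableS (L2_mul_integrable LF LF).
have gi : mu.-integrable `[x, x + 1] (EFin \o (fun t => g t * g t)).
  by apply: integrableS (L2_mul_integrable Lg Lg).
have H t : `[x, x + 1]%classic t -> F x ^+ 2 <= 2 * (F t * F t) + 2 * J.
  rewrite /= in_itv /= => /andP[xt tx].
  have h1 := sqr_Rintegral_itv_le xt Lg; rewrite -Fg// in h1.
  have h2 : \int[mu]_(u in `[x, t]) (g u * g u) <= J.
    rewrite /J (Rintegral_itv_cat xt tx gi) lerDl.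
    by apply: Rintegral_ge0 => u _; rewrite -expr2 sqr_ge0.
  have h3 : 0 <= \int[mu]_(u in `[x, t]) (g u * g u).
    by apply: Rintegral_ge0 => u _; rewrite -expr2 sqr_ge0.
  have h4 : (F t - F x) ^+ 2 <= J.
    by apply: le_trans h1 (le_trans _ h2); rewrite ler_piMl//; lra.
  (* The defect in the inequality being averaged is exactly this square. *)
  have := sqr_ge0 (2 * F t - F x); nra.
have ci c : mu.-integrable `[x, x + 1] (EFin \o cst c).
  by apply: continuous_integrable_itv; exact: cst_continuous.
have E c : \int[mu]_(t in `[x, x + 1]) c = c by rewrite Rintegral_itv_cst//; ring.
have -> : 2 * \int[mu]_(t in `[x, x + 1]) (F t * F t) + 2 * J =
    \int[mu]_(t in `[x, x + 1]) (2 * (F t * F t) + 2 * J).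
  have i1 : mu.-integrable `[x, x + 1] (EFin \o (fun t => 2 * (F t * F t))).
    exact: integrable_scale.
  by rewrite RintegralD ?RintegralZl ?E//; exact: ci.
rewrite -[X in X <= _]E; apply: le_Rintegral => //; first exact: ci.
by apply: integrable_add => //; [exact: integrable_scale|exact: ci].
Qed.

Lemma primitive_sup F g x : is_L2 F -> is_L2 g -> primitive F g ->
  F x ^+ 2 <= 2 * (sqnorm F + sqnorm g).
Proof.
move=> LF Lg Fg; apply: le_trans (primitive_sqr_le x LF Lg Fg) _.
rewrite mulrDr lerD// ler_wpM2l// Rintegral_le_setT//; try exact: L2_mul_integrable.
- by move=> t; rewrite -expr2 sqr_ge0.
- by move=> t; rewrite -expr2 sqr_ge0.
Qed.

Lemma primitive_vanish F g (e : R) : is_L2 F -> is_L2 g -> primitive F g -> 0 < e ->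
  exists2 M : R, 0 < M & forall x, M <= `|x| -> `|F x| <= e.
Proof.
move=> LF Lg Fg e0.
have e4 : 0 < e ^+ 2 / 4 by rewrite divr_gt0// exprn_gt0.
have sq0 (f : R -> R) t : 0 <= f t * f t by rewrite -expr2 sqr_ge0.
have [M M0 HM] := Rintegral_tail_cvg0 (L2_mul_integrable LF LF) (sq0 F) e4.
have [N N0 HN] := Rintegral_tail_cvg0 (L2_mul_integrable Lg Lg) (sq0 g) e4.
(* The extra 1 keeps the whole window [x, x + 1] in the left tail when [x] is negative. *)
exists (M + N + 1) => [|x]; first lra.
rewrite ler_normr => Hx.
have MH : (M <= x) || (x + 1 <= - M) by case/orP : Hx => ?; apply/orP; [left|right]; lra.
have NH : (N <= x) || (x + 1 <= - N) by case/orP : Hx => ?; apply/orP; [left|right]; lra.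
have h1 := HM _ _ MH; have h2 := HN _ _ NH.
have h3 := primitive_sqr_le x LF Lg Fg.
rewrite -(ler_pXn2r (n := 2)) ?nnegrE ?(ltW e0)// -normrX ger0_norm ?sqr_ge0//.
lra.
Qed.

(** * Continuous representatives of weak derivatives *)

Lemma test_function_derive1 (phi : R -> R) : test_function phi -> test_function phi^`()%classic.
Proof.
move=> [dphi cphi].
have dE n : (phi^`()^`(n))%classic = (phi^`(n.+1))%classic.
  by rewrite /derive1n iterSr.
split=> [n x|]; first by rewrite dE.
apply: subclosed_compact cphi _; first exact: closed_closure.
rewrite [X in _ `<=` X](closure_id (closure [set x | phi x != 0])).1;
  last exact: closed_closure.
apply: closureS => x /= dx; apply: contrapT => xn.
(* Around a point outside the closed support [phi] vanishes identically, hence so does its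
   derivative. *)
have /= nx : \forall y \near x, phi y = 0.
  have : nbhs x (~` closure [set x | phi x != 0]).
    by apply: open_nbhs_nbhs; split => //; apply: closed_openC; exact: closed_closure.
  apply: filterS => y /= yn; apply/eqP; apply: contrapT => /negP py; apply: yn.
  exact: subset_closure.
move/eqP : dx; apply; rewrite derive1E.
have /(near_eq_derive (1 : R)) -> : \near x, phi x = cst 0 x by [].
exact: derive_cst.
Qed.

(** In [sobolev] every order is a weak derivative of [f] itself. Testing order [k] against the
    derivative of [phi] links consecutive orders, which the embedding requires. *)
Lemma is_weak_derivative_step f g1 g2 k : is_weak_derivative k f g1 ->
  is_weak_derivative k.+1 f g2 -> is_weak_derivative 1 g1 g2.
Proof.
move=> fg1 fg2 phi tphi.
have := fg1 _ (test_function_derive1 tphi).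
have -> : (phi^`()^`(k))%classic = (phi^`(k.+1))%classic by rewrite /derive1n iterSr.
rewrite fg2// exprS derive1n1 expr1; set e : R := (-1) ^+ k => H.
have ee : e * e = 1 by rewrite -expr2 sqrr_sign.
rewrite -[LHS]mul1r -ee -mulrA -H !mulrA [e * -1]mulrC -(mulrA (-1)) ee mulr1//.
Qed.

Lemma sobolev_weak_derivative s f k : sobolev s f -> (k <= s)%N ->
  is_L2 (weak_derivative k f) /\ is_weak_derivative k f (weak_derivative k f).
Proof.
move=> [_ Hf] /Hf[g Lg fg].
by apply: (@xgetPex _ (cst 0) [set g | g \in Lfun mu 2%:E /\ is_weak_derivative k f g]);
  exists g.
Qed.

(** For [k = 0] too this starts from the chosen weak derivative and not from [f], so that all orders
    are treated alike; [crep0_ae] leads back to [f]. *)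
Definition crep k f : R -> R := continuous_representative (weak_derivative k f).

Lemma crepP s f k : sobolev s f -> (k < s)%N ->
  [/\ {ae mu, forall x, crep k f x = weak_derivative k f x}, is_L2 (crep k f) &
      primitive (crep k f) (weak_derivative k.+1 f)].
Proof.
move=> sf ks.
have [L1 w1] := sobolev_weak_derivative sf (ltnW ks).
have [L2 w2] := sobolev_weak_derivative sf ks.
have [F [Ff LF Fg]] := sobolev_embedding L1 L2 (is_weak_derivative_step w1 w2).
have cF := primitive_continuous L2 Fg.
have [cC Cae] : continuous (crep k f) /\ {ae mu, forall x, crep k f x = weak_derivative k f x}.
  apply: (@xgetPex _ (weak_derivative k f) [set g | continuous g /\ {ae mu, forall x, g x =
    weak_derivative k f x}]).
  by exists F.
(* Continuous functions equal almost everywhere coincide, so the arbitrary choice in [crep] is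
   [F]. *)
have -> : crep k f = F.
  by apply: ae_eq_continuous => //; apply: ae_imply2 Cae Ff => x -> ->.
by split.
Qed.

Lemma crep_continuous s f k : sobolev s f -> (k < s)%N -> continuous (crep k f).
Proof.
move=> sf ks; have [_ _ ] := crepP sf ks.
by apply: primitive_continuous; exact: (sobolev_weak_derivative sf ks).1.
Qed.

Lemma crep_is_derive s f k x : sobolev s f -> (k.+1 < s)%N ->
  is_derive x 1 (crep k f) (crep k.+1 f x).
Proof.
move=> sf ks; have [_ _ P] := crepP sf (ltnW ks).
have [E _ _] := crepP sf ks.
have c := crep_continuous sf ks.
apply: primitive_is_derive => // a b ab; rewrite P//.
apply: eq_ae_Rintegral => //.
- by apply: measurable_funTS; apply: L2_measurable;
  exact: (sobolev_weak_derivative sf (ltnW ks)).1.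
- by apply: measurable_funTS; exact: continuous_measurable_fun.
- by apply: ae_imply E.
Qed.

Lemma crep0_ae s f : sobolev s f -> (0 < s)%N -> {ae mu, forall x, crep 0 f x = f x}.
Proof.
move=> sf s0; have [E _ _] := crepP sf s0.
have [Lw w] := sobolev_weak_derivative sf (leq0n s).
have := fundamental_lemma (L2_locally_integrable sf.1) (L2_locally_integrable Lw) w.
by apply: ae_imply2 E => x -> ->.
Qed.

Lemma sobolev_norm_ge0 s f : 0 <= sobolev_norm s f.
Proof. exact: sqrtr_ge0. Qed.

Lemma sobolev_norm_sqr s f : sobolev s f ->
  sobolev_norm s f ^+ 2 = \sum_(k < s.+1) sqnorm (weak_derivative k f).
Proof.
move=> sf; rewrite sqr_sqrtr; last by apply: sumr_ge0 => k _; exact: sqr_ge0.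
apply: eq_bigr => k _; rewrite sqnormE//.
by apply: (sobolev_weak_derivative sf _).1; rewrite -ltnS.
Qed.

Lemma sqnorm_weak_derivative_le s f k : sobolev s f -> (k <= s)%N ->
  sqnorm (weak_derivative k f) <= sobolev_norm s f ^+ 2.
Proof.
move=> sf ks; rewrite sobolev_norm_sqr// (bigD1 (Ordinal (ks : (k < s.+1)%N)))//= lerDl.
by apply: sumr_ge0 => i _; exact: sqnorm_ge0.
Qed.

(** The factor 2 is the square root of 2 (1 + 1): [primitive_sup] involves two summands of the
    squared Sobolev norm, each at most the whole. *)
Lemma crep_sup s f k x : sobolev s f -> (k < s)%N -> `|crep k f x| <= 2 * sobolev_norm s f.
Proof.
move=> sf ks; have [E LC P] := crepP sf ks.
have [L1 _] := sobolev_weak_derivative sf (ltnW ks).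
have [L2 _] := sobolev_weak_derivative sf ks.
have h := primitive_sup x LC L2 P.
rewrite (eq_ae_sqnorm LC L1 E) in h.
have h1 := sqnorm_weak_derivative_le sf (ltnW ks).
have h2 := sqnorm_weak_derivative_le sf ks.
rewrite -(ler_pXn2r (n := 2)) ?nnegrE ?mulr_ge0 ?sobolev_norm_ge0// -normrX ger0_norm
  ?sqr_ge0//.
lra.
Qed.

Lemma crep_vanish s f k (e : R) : sobolev s f -> (k < s)%N -> 0 < e ->
  exists2 M : R, 0 < M & forall x, M <= `|x| -> `|crep k f x| <= e.
Proof.
move=> sf ks; have [E LC P] := crepP sf ks.
by apply: (primitive_vanish LC _ P); exact: (sobolev_weak_derivative sf ks).1.
Qed.

End Sobolev1.

(** * Exponential averages *)

Section ExponentialAverages.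
Context {R : realType}.
Notation mu := (@lebesgue_measure R).
Implicit Types (a b c x y C : R) (f g h H : R -> R).

Lemma is_derive_expRN x : is_derive x 1 (fun y : R => expR (- y)) (- expR (- x)).
Proof.
have := @is_derive1_comp _ expR -%R x _ _ (is_derive_expR (- x)) (is_deriveN (is_derive_id
  x 1)).
by rewrite mulrN1.
Qed.

Lemma integral_expRN x : (\int[mu]_(y in `[x, +oo[) (expR (- y))%:E = (expR (- x))%:E)%E.
Proof.
have d y : is_derive y 1 (fun t : R => - expR (- t)) (expR (- y)).
  by have := is_deriveN (is_derive_expRN y); rewrite opprK.
rewrite (@ge0_continuous_FTC2y _ _ (fun t : R => - expR (- t)) x 0).
- by rewrite sub0e -EFinN opprK.
- by move=> y _; exact: expR_ge0.
- by apply: continuous_subspaceT => y; apply: continuous_comp;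
  [exact: opp_continuous|exact: continuous_expR].
- by rewrite -oppr0; apply: cvgN; exact: cvgr_expR.
- by move=> y _; have [] := d y.
- by apply: cvg_at_right_filter; exact: (is_derive_continuous d).
- by move=> y _; rewrite derive1E; have [_ ->] := d y.
Qed.

Lemma integral_expR x : (\int[mu]_(y in `]-oo, x]) (expR y)%:E = (expR x)%:E)%E.
Proof.
have := @ge0_integration_by_substitutionNy R expR (- x).
rewrite opprK => -> //.
- by rewrite integral_expRN opprK.
- by apply: continuous_subspaceT; exact: continuous_expR.
Qed.

Lemma integrable_expRN x : mu.-integrable `[x, +oo[ (EFin \o (fun y => expR (- y))).
Proof.
apply/integrableP; split.
  apply/measurable_EFinP; apply: measurable_funTS; apply: continuous_measurable_fun => y.
  by apply: continuous_comp; [exact: opp_continuous|exact: continuous_expR].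
under eq_integral => y _ do rewrite /= ger0_norm ?expR_ge0//.
by rewrite integral_expRN ltry.
Qed.

Lemma integrable_expR x : mu.-integrable `]-oo, x] (EFin \o (fun y => expR y)).
Proof.
apply/integrableP; split.
  by apply/measurable_EFinP; apply: measurable_funTS; apply: continuous_measurable_fun;
    exact: continuous_expR.
under eq_integral => y _ do rewrite /= ger0_norm ?expR_ge0//.
by rewrite integral_expR ltry.
Qed.

(** The convolution of [h] with exp(-z) on z > 0, a weight of mass 1. Together with the mirror image
    [rexpavg] it splits the kernel at its kink. *)
Definition lexpavg h x : R := expR (- x) * \int[mu]_(y in `]-oo, x]) (expR y * h y).
Definition rexpavg h x : R := expR x * \int[mu]_(y in `]x, +oo[) (expR (- y) * h y).

Section OneFunction.
Variables (h : R -> R) (C0 : R).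
Hypothesis (ch : continuous h) (hC0 : forall y, `|h y| <= C0).

Let lint x : mu.-integrable `]-oo, x] (EFin \o (fun y => expR y * h y)).
Proof.
apply: integrable_bounded_mul (fun y _ => hC0 y) => //; first exact: integrable_expR.
by apply: measurable_funTS; exact: continuous_measurable_fun.
Qed.

Let rint x : mu.-integrable `]x, +oo[ (EFin \o (fun y => expR (- y) * h y)).
Proof.
apply: integrable_bounded_mul (fun y _ => hC0 y) => //; last first.
  by apply: measurable_funTS; exact: continuous_measurable_fun.
by apply: integrableS (integrable_expRN x) => //; apply: subset_itvr; rewrite bnd_simp.
Qed.

(** [C] may be smaller than the global bound [C0], since only values of [h] to the left of [x]
    enter; this yields decay at infinity. *)
Lemma lexpavg_le C x : (forall y, y <= x -> `|h y| <= C) -> `|lexpavg h x| <= C.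
Proof.
move=> hC; rewrite /lexpavg normrM ger0_norm ?expR_ge0// expRN mulrC ler_pdivrMr ?expR_gt0//.
apply: le_trans (le_normr_Rintegral _ (lint x)) _ => //.
apply: (@le_trans _ _ (\int[mu]_(y in `]-oo, x]) (C * expR y))).
  apply: le_Rintegral => //.
  - exact: integrable_norm.
  - by apply: integrable_scale => //; exact: integrable_expR.
  - move=> y; rewrite /= in_itv /= => yx.
    by rewrite normrM ger0_norm ?expR_ge0// mulrC ler_wpM2r ?expR_ge0// hC.
rewrite RintegralZl//; last exact: integrable_expR.
by rewrite /Rintegral integral_expR.
Qed.

Lemma rexpavg_le C x : (forall y, x <= y -> `|h y| <= C) -> `|rexpavg h x| <= C.
Proof.
move=> hC; rewrite /rexpavg normrM ger0_norm ?expR_ge0// -[x in expR x]opprK expRN mulrC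
  ler_pdivrMr ?expR_gt0//.
apply: le_trans (le_normr_Rintegral _ (rint x)) _ => //.
have i1 : mu.-integrable `]x, +oo[ (EFin \o (fun y => expR (- y))).
  by apply: integrableS (integrable_expRN x) => //; apply: subset_itvr; rewrite bnd_simp.
apply: (@le_trans _ _ (\int[mu]_(y in `]x, +oo[) (C * expR (- y)))).
  apply: le_Rintegral => //.
  - exact: integrable_norm.
  - exact: integrable_scale.
  - move=> y; rewrite /= in_itv /= andbT => yx.
    by rewrite normrM ger0_norm ?expR_ge0// mulrC ler_wpM2r ?expR_ge0// hC// ltW.
rewrite RintegralZl// Rintegral_itv_obnd_cbnd//.
by rewrite /Rintegral integral_expRN.
Qed.

Let ceh : continuous (fun y => expR y * h y).
Proof. by move=> y; apply: cvgM; [exact: continuous_expR|exact: ch]. Qed.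

Let cenh : continuous (fun y => expR (- y) * h y).
Proof.
move=> y; apply: cvgM; last exact: ch.
exact: (is_derive_continuous is_derive_expRN).
Qed.

Lemma is_derive_lexpavg x : is_derive x 1 (lexpavg h) (h x - lexpavg h x).
Proof.
have [||||d e] := @continuous_FTC1 R (fun y => expR y * h y) -oo%O x (x + 1).
- by rewrite ltrDl.
- exact: lint.
- by rewrite ltNyr.
- exact: ceh.
have dI : is_derive x 1 (fun y => \int[mu]_(t in `]-oo, y]) (expR t * h t)) (expR x * h x).
  by apply: DeriveDef; [exact: d|rewrite -e derive1E].
apply: is_derive_eq (is_deriveM (is_derive_expRN x) dI) _.
rewrite /GRing.scale /= /lexpavg mulrA -expRD addNr expR0; ring.
Qed.

Lemma is_derive_rexpavg x : is_derive x 1 (rexpavg h) (rexpavg h x - h x).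
Proof.
set g := fun y => expR (- y) * h y; set a := x - 1.
have ig y : mu.-integrable `]a, y] (EFin \o g).
  by apply: integrableS (rint a) => //; apply: subset_itvl; rewrite bnd_simp.
have [||||d e] := @continuous_FTC1 R g (BRight a) x (x + 1).
- by rewrite ltrDl.
- exact: ig.
- by rewrite /Order.lt /= /a; lra.
- exact: cenh.
have dI : is_derive x 1 (fun y => \int[mu]_(t in `]a, y]) g t) (g x).
  by apply: DeriveDef; [exact: d|rewrite -e derive1E].
have dJ : is_derive x 1 (fun y => \int[mu]_(t in `]y, +oo[) g t) (- g x).
  have := is_deriveB (is_derive_cst (\int[mu]_(t in `]a, +oo[) g t) x 1) dI.
  rewrite sub0r; apply: near_eq_is_derive; near=> y.
  have ay : a <= y.
    rewrite /a lerBlDr -lerN2 opprD lerBlDr; apply: ltW; near: y; apply: Nlt_nbhsl; lra.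
  have := Rintegral_itvB (rint a) (x := y); rewrite !bnd_simp => /(_ ay isT) <-//.
apply: is_derive_eq (is_deriveM (is_derive_expR x) dJ) _.
rewrite /GRing.scale /= /rexpavg /g mulrN mulrA -expRD subrr expR0; ring.
Unshelve. all: by end_near. Qed.

Lemma convolution_FW_kernel w x : measurable_fun setT w ->
  {ae mu, forall y, h y = w y} ->
  convolution FW_kernel w x = 2^-1 * (lexpavg h x + rexpavg h x).
Proof.
move=> mw hw; rewrite /convolution.
have mK : measurable_fun setT (fun y => FW_kernel (x - y) : R).
  apply: continuous_measurable_fun => y; apply: cvgM; first exact: cvg_cst.
  apply: continuous_comp; last exact: continuous_expR.
  apply: cvgN; apply: cvg_norm; apply: cvgB; [exact: cvg_cst|exact: cvg_id].
have mh : measurable_fun setT h by exact: continuous_measurable_fun.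
rewrite (@eq_ae_Rintegral _ _ _ (fun y => FW_kernel (x - y) * h y))//; last 3 first.
- exact: measurable_funM.
- exact: measurable_funM.
- by apply: ae_imply hw => y ->.
have El y : `]-oo, x]%classic y -> FW_kernel (x - y) * h y = 2^-1 * expR (- x) * (expR y * h y).
  rewrite /= in_itv /= => yx; rewrite /FW_kernel ger0_norm ?subr_ge0// opprB expRD; ring.
have Er y : `]x, +oo[%classic y -> FW_kernel (x - y) * h y = 2^-1 * expR x * (expR (- y) * h y).
  rewrite /= in_itv /= andbT => yx; rewrite /FW_kernel ltr0_norm ?subr_lt0// opprK expRD; ring.
have il : mu.-integrable `]-oo, x] (EFin \o (fun y => FW_kernel (x - y) * h y)).
  apply: eq_integrable (integrable_scale (2^-1 * expR (- x)) _ (lint x)) => //.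
  by move=> y; rewrite inE => /El /= ->.
have ir : mu.-integrable `]x, +oo[ (EFin \o (fun y => FW_kernel (x - y) * h y)).
  apply: eq_integrable (integrable_scale (2^-1 * expR x) _ (rint x)) => //.
  by move=> y; rewrite inE => /Er /= ->.
have ir' (E : set R) : measurable (E : set (measurableTypeR R)) ->
    mu.-integrable E (EFin \o (fun y => FW_kernel (x - y) * h y)) ->
    mu.-integrable setT (EFin \o ((fun y => FW_kernel (x - y) * h y) \_ E)).
  by move=> mE Ei; rewrite -restrict_EFin; apply/integrable_restrict => //; rewrite setTI.
have TE : [set: R] = `]-oo, x] `|` `]x, +oo[.
  apply/seteqP; split => // y _ /=; rewrite !in_itv /= andbT.
  by have [|] := leP y x; [left|right].
rewrite TE Rintegral_setU//; last 2 first.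
- rewrite -TE; have := integrable_add measurableT (ir' _ (measurable_itv _) il) (ir' _
  (measurable_itv _) ir); congr (mu.-integrable _ (_ \o _)).
  apply/funext => y; rewrite !patchE; case: ifPn; case: ifPn; rewrite ?inE /= ?in_itv /= ?andbT.
  + by move=> xy yx; move: (lt_le_trans xy yx); rewrite ltxx.
  + by rewrite addr0.
  + by rewrite add0r.
  + by move=> /negP; rewrite inE /= in_itv /= andbT => /negP; rewrite -leNgt => yx /negP;
    rewrite inE /= in_itv /= yx.
- apply/disj_setPS => y [/=]; rewrite !in_itv /= andbT => yx xy.
  by move: (lt_le_trans xy yx); rewrite ltxx.
have -> : \int[mu]_(y in `]-oo, x]) (FW_kernel (x - y) * h y) =
    2^-1 * expR (- x) * \int[mu]_(y in `]-oo, x]) (expR y * h y).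
  by rewrite -RintegralZl//; apply: eq_Rintegral => y; rewrite inE => /El.
have -> : \int[mu]_(y in `]x, +oo[) (FW_kernel (x - y) * h y) =
    2^-1 * expR x * \int[mu]_(y in `]x, +oo[) (expR (- y) * h y).
  by rewrite -RintegralZl//; apply: eq_Rintegral => y; rewrite inE => /Er.
rewrite /lexpavg /rexpavg; ring.
Qed.

End OneFunction.

(** The product exp(x) D(x) is constant, and it tends to 0 at minus infinity because [D] is
    bounded. *)
Lemma bounded_decay_eq0 (D : R -> R) C : (forall x, `|D x| <= C) ->
  (forall x : R, is_derive x 1 D (- D x)) -> forall x, D x = 0.
Proof.
move=> DC dD x.
have dE y : is_derive y 1 (fun t => expR t * D t) 0.
  apply: is_derive_eq (is_deriveM (is_derive_expR y) (dD y)) _.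
  by rewrite /GRing.scale /=; ring.
have cE y : expR y * D y = expR x * D x by exact: (is_derive_0_is_cst _ _ dE).
have C0 : 0 <= C by apply: le_trans (DC 0).
apply/eqP; rewrite -normr_eq0 eq_le normr_ge0 andbT.
apply/ler_addgt0Pl => e e0; rewrite addr0.
have [y ye] : exists y, expR y * C <= e * expR x.
  (* Chosen so that exp z >= 1 + z, with z = C / (e exp x), gives the required smallness. *)
  exists (- (C / (e * expR x))).
  have p : 0 < e * expR x by rewrite mulr_gt0// expR_gt0.
  rewrite expRN mulrC ler_pdivrMr ?expR_gt0//.
  have := expR_ge1Dx (C / (e * expR x)); rewrite -(ler_pM2l p) => h.
  apply: le_trans h; rewrite mulrDr mulr1 [X in _ + X]mulrC divfK ?gt_eqF//; lra.
rewrite -(ler_pM2r (expR_gt0 x)) (le_trans _ ye)//.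
rewrite mulrC -[X in X * _]ger0_norm ?expR_ge0// -normrM -(cE y) normrM ger0_norm ?expR_ge0//.
by rewrite ler_wpM2l ?expR_ge0.
Qed.

Lemma bounded_growth_eq0 (D : R -> R) C : (forall x, `|D x| <= C) ->
  (forall x : R, is_derive x 1 D (D x)) -> forall x, D x = 0.
Proof.
move=> DC dD x; rewrite -[x]opprK.
apply: (@bounded_decay_eq0 (D \o -%R) C (fun y => DC (- y))) => y.
have := @is_derive1_comp _ D -%R y _ _ (dD (- y)) (is_deriveN (is_derive_id y 1)).
by rewrite mulrN1.
Qed.

(** Integration by parts with no boundary term at minus infinity: the difference of the two sides is
    bounded and solves D' = - D. *)
Lemma lexpavg_derive h H C : continuous h -> (forall y, `|h y| <= C) ->
  (forall y, `|H y| <= C) -> (forall y : R, is_derive y 1 H (h y)) ->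
  forall x, lexpavg h x = H x - lexpavg H x.
Proof.
move=> ch hC HC dH x; have cH := is_derive_continuous dH.
apply/eqP; rewrite -subr_eq0 opprB addrA; apply/eqP.
apply: (@bounded_decay_eq0 (fun x => lexpavg h x + lexpavg H x - H x) (C + C + C)) => y.
  have l1 := lexpavg_le ch hC (fun y _ => hC y) (x := y).
  have l2 := lexpavg_le cH HC (fun y _ => HC y) (x := y).
  rewrite (le_trans (ler_normB _ _))// lerD// (le_trans (ler_normD _ _))// lerD//.
apply: is_derive_eq (is_deriveB (is_deriveD (is_derive_lexpavg ch hC y) (is_derive_lexpavg
  cH HC y)) (dH y)) _.
ring.
Qed.

Lemma rexpavg_derive h H C : continuous h -> (forall y, `|h y| <= C) ->
  (forall y, `|H y| <= C) -> (forall y : R, is_derive y 1 H (h y)) ->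
  forall x, rexpavg h x = rexpavg H x - H x.
Proof.
move=> ch hC HC dH x; have cH := is_derive_continuous dH.
apply/eqP; rewrite -subr_eq0 opprB addrA; apply/eqP.
apply: (@bounded_growth_eq0 (fun x => rexpavg h x + H x - rexpavg H x) (C + C + C)) => y.
  have l1 := rexpavg_le ch hC (fun y _ => hC y) (x := y).
  have l2 := rexpavg_le cH HC (fun y _ => HC y) (x := y).
  rewrite (le_trans (ler_normB _ _))// lerD// (le_trans (ler_normD _ _))// lerD//.
apply: is_derive_eq (is_deriveB (is_deriveD (is_derive_rexpavg ch hC y) (dH y))
  (is_derive_rexpavg cH HC y)) _.
ring.
Qed.

End ExponentialAverages.

(** * The equation at a fixed time *)

Section FixedTime.
Context {R : realType}.
Notation mu := (@lebesgue_measure R).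
Implicit Types (a b c x y C e : R) (f g h H Q : R -> R).

Definition vanishes_at_infinity Q := forall e, 0 < e ->
  exists2 M : R, 0 < M & forall x, M <= `|x| -> `|Q x| <= e.

Lemma Rintegral_derive_eq0 Q h : continuous h -> mu.-integrable setT (EFin \o h) ->
  (forall x : R, is_derive x 1 Q (h x)) -> vanishes_at_infinity Q ->
  \int[mu]_x h x = 0.
Proof.
move=> ch hi dQ vQ.
pose I n := `[- n%:R, n%:R]%classic : set R.
have mh : measurable_fun setT h by exact: continuous_measurable_fun.
have c : \int[mu]_x (h \_ (I n)) x @[n --> \oo] --> \int[mu]_x h x.
  apply: (@cvg_Rintegral _ _ _ _ (fun x => `|h x|)) => //.
  - move=> n; apply/(measurable_restrictT _ _).1; first exact: measurable_itv.
    exact: measurable_funTS.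
  - apply: aeW => x _; apply: cvg_near_cst; near=> n.
    rewrite patchE mem_set// /I /= in_itv /= -ler_norml ltW//.
    near: n; exact: nbhs_infty_gtr.
  - exact: integrable_norm.
  - move=> n x _; rewrite patchE; case: ifPn => // _.
    by rewrite (_ : (point : R) = 0)// normr0.
have c0 : \int[mu]_x (h \_ (I n)) x @[n --> \oo] --> (0 : R).
  apply/cvgrPdist_le => e e0.
  have [M M0 HM] := vQ (e / 2) (ltac:(by rewrite divr_gt0)).
  near=> n.
  have Mn : M <= n%:R by apply: ltW; near: n; exact: nbhs_infty_gtr.
  rewrite sub0r normrN -Rintegral_mkcond (Rintegral_derive _ ch dQ)//; last lra.
  have n0 : 0 <= n%:R :> R by lra.
  have := HM n%:R; rewrite (ger0_norm n0) => /(_ Mn) h1.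
  have := HM (- n%:R); rewrite normrN (ger0_norm n0) => /(_ Mn) h2.
  apply: le_trans (ler_normB _ _) _; lra.
exact: (norm_cvg_unique c c0).
Unshelve. all: by end_near. Qed.

(** At each end of the line one factor sees only small values of [h], while the other is merely
    bounded. *)
Lemma vanishes_lexpavg_rexpavg h C : continuous h -> (forall x, `|h x| <= C) ->
  vanishes_at_infinity h -> vanishes_at_infinity (fun x => lexpavg h x * rexpavg h x).
Proof.
move=> ch hC vh e e0.
have C0 : 0 <= C by apply: le_trans (hC 0).
have C1 : 0 < C + 1 by lra.
have [M M0 HM] := vh _ (divr_gt0 e0 C1).
exists M => // x; rewrite ler_normr => Hx.
have A1 : `|lexpavg h x| <= C by apply: (lexpavg_le ch hC).
have B1 : `|rexpavg h x| <= C by apply: (rexpavg_le ch hC).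
have eC : 0 <= e / (C + 1) by rewrite ltW// divr_gt0.
have E : e / (C + 1) * (C + 1) = e by rewrite divfK// gt_eqF.
rewrite normrM; case/orP : Hx => Hx.
- have B2 : `|rexpavg h x| <= e / (C + 1).
    apply: (rexpavg_le ch hC) => y xy; apply: HM; rewrite ler_normr; apply/orP; left; lra.
  by rewrite -E mulrC ler_pM//; lra.
- have A2 : `|lexpavg h x| <= e / (C + 1).
    apply: (lexpavg_le ch hC) => y xy; apply: HM; rewrite ler_normr; apply/orP; right; lra.
  by rewrite -E ler_pM//; lra.
Qed.

(** * Pointwise consequences of the equation *)

Section Equation.
Variables (f g : R -> R).
Hypothesis (sf : sobolev 3 f) (sg : sobolev 2 g).
Hypothesis equation : {ae mu, forall x, g x + f x * weak_derivative 1 f x +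
  convolution FW_kernel (weak_derivative 1 f) x = 0}.

Let U := crep 0 f.
Let W := crep 1 f.
Let V := crep 0 g.
Let A := lexpavg U.
Let B := rexpavg U.
Let C := 2 * sobolev_norm 3 f.

Let cU : continuous U. Proof. exact: crep_continuous sf _. Qed.
Let cW : continuous W. Proof. exact: crep_continuous sf _. Qed.
Let cV : continuous V. Proof. exact: crep_continuous sg _. Qed.
Let UC x : `|U x| <= C. Proof. exact: crep_sup sf _. Qed.
Let WC x : `|W x| <= C. Proof. exact: crep_sup sf _. Qed.
Let dU (x : R) : is_derive x 1 U (W x). Proof. exact: crep_is_derive sf _. Qed.
Let dA (x : R) : is_derive x 1 A (U x - A x). Proof. exact: is_derive_lexpavg cU UC x. Qed.
Let dB (x : R) : is_derive x 1 B (B x - U x). Proof. exact: is_derive_rexpavg cU UC x. Qed.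
Let cA : continuous A. Proof. exact: is_derive_continuous dA. Qed.
Let cB : continuous B. Proof. exact: is_derive_continuous dB. Qed.

(** Both sides are continuous, so the identity between classes holds at every point. Expressed
    through [A] and [B], the nonlocal term has an explicit derivative, ready for [FW_derivative]. *)
Lemma FW_pointwise x : V x = - (U x * W x + 2^-1 * (B x - A x)).
Proof.
pose F x := - (U x * W x + 2^-1 * (B x - A x)).
suff -> : V = F by [].
have cF : continuous F.
  move=> y; apply: cvgN; apply: cvgD; first by apply: cvgM; [exact: cU|exact: cW].
  by apply: cvgM; [exact: cvg_cst|apply: cvgB; [exact: cB|exact: cA]].
apply: ae_eq_continuous => //.
have [EW _ _] := crepP sf (isT : (1 < 3)%N).
have mw := L2_measurable (sobolev_weak_derivative sf (isT : (1 <= 3)%N)).1.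
have conv y : convolution FW_kernel (weak_derivative 1 f) y = 2^-1 * (B y - A y).
  rewrite (convolution_FW_kernel cW WC y mw EW).
  rewrite (lexpavg_derive cW WC UC dU) (rexpavg_derive cW WC UC dU) /A /B; ring.
have E1 := ae_and equation EW.
have E2 := ae_and (crep0_ae sf isT) (crep0_ae sg isT).
apply: ae_imply2 E1 E2 => y [e1 e2] [e3 e4].
move: e1; rewrite conv -e2 -e3 -e4 -/U -/V -/W /F => e1.
by apply/eqP; rewrite -addr_eq0 addrA; exact/eqP.
Qed.

Lemma FW_derivative x :
  crep 1 g x = - (W x) ^+ 2 - U x * crep 2 f x + U x - 2^-1 * (A x + B x).
Proof.
have d1 : is_derive x 1 V (crep 1 g x) by exact: crep_is_derive sg _.
have dW : is_derive x 1 W (crep 2 f x) by exact: crep_is_derive sf _.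
have VE : V = (fun x => - (U x * W x + 2^-1 * (B x - A x))) by apply/funext => y;
  exact: FW_pointwise.
have d2 : is_derive x 1 V (- ((U x *: crep 2 f x + W x *: W x) + 2^-1 *: ((B x - U x) - (U
  x - A x)))).
  rewrite VE; apply: is_deriveN; apply: is_deriveD; first exact: is_deriveM.
  by apply: is_deriveZ; exact: is_deriveB.
have [_ <-] := d1; have [_ ->] := d2.
by rewrite /GRing.scale /=; field.
Qed.

Let vU : vanishes_at_infinity U. Proof. by move=> e e0; apply: (crep_vanish sf). Qed.



(** Half the time derivative of the energy. The nonlocal term is an exact derivative because (A B)'
    = (U - A) B + A (B - U) = U (B - A). *)
Lemma FW_orthogonal : \int[mu]_x (f x * g x) = 0.
Proof.
have [_ LU _] := crepP sf (isT : (0 < 3)%N).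
have [_ LV _] := crepP sg (isT : (0 < 2)%N).
rewrite -(@eq_ae_Rintegral _ _ (fun x => U x * V x))//; last 3 first.
- exact: measurable_funM (L2_measurable LU) (L2_measurable LV).
- exact: measurable_funM (L2_measurable sf.1) (L2_measurable sg.1).
- by apply: ae_imply2 (crep0_ae sf isT) (crep0_ae sg isT) => x; rewrite /U /V => -> ->.
pose Q x := - (3^-1 * (U x ^+ 3) + 2^-1 * (A x * B x)).
apply: (@Rintegral_derive_eq0 Q (fun x => U x * V x)).
- by move=> x; apply: cvgM; [exact: cU|exact: cV].
- exact: L2_mul_integrable LU LV.
- move=> x; have := is_deriveN (is_deriveD (is_deriveZ 3^-1 (is_deriveX 3 (dU x)))
    (is_deriveZ 2^-1 (is_deriveM (dA x) (dB x)))).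
  move=> d; apply: (is_derive_eq d).
  by rewrite FW_pointwise /GRing.scale /=; field.
- move=> e e0.
  (* The cap at 1 lets |U| <= d imply |U|^3 <= d. *)
  pose d := Num.min 1 e.
  have d0 : 0 < d by rewrite lt_min ltr01.
  have d1 : d <= 1 by rewrite ge_min lexx.
  have de : d <= e by rewrite ge_min lexx orbT.
  have [M M0 HM] := vU d0.
  have [N N0 HN] := vanishes_lexpavg_rexpavg cU UC vU e0.
  exists (M + N) => [|x Hx]; first lra.
  have h1 : `|U x| <= d by apply: HM; lra.
  have h2 : `|A x * B x| <= e by apply: HN; lra.
  have h3 : `|U x ^+ 3| <= d.
    rewrite normrX -[X in _ <= X]mulr1 exprS ler_pM//.
    by rewrite exprn_ile1// (le_trans h1).
  have h4 : `|3^-1 * U x ^+ 3| <= 3^-1 * d by rewrite normrM ger0_norm// ler_wpM2l.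
  have h5 : `|2^-1 * (A x * B x)| <= 2^-1 * e by rewrite normrM [`|2^-1|]ger0_norm// ler_wpM2l.
  rewrite /Q normrN (le_trans (ler_normD _ _))//.
  apply: le_trans (lerD h4 h5) _; lra.
Qed.

End Equation.
End FixedTime.

(** * Linear combinations and maxima *)

Section LinearCombinations.
Context {R : realType}.
Notation mu := (@lebesgue_measure R).
Implicit Types (a c x y : R) (f g h phi F : R -> R) (s k : nat).

Lemma test_function_derive1n phi k : test_function phi -> test_function (phi^`(k))%classic.
Proof.
by move=> tphi; elim: k => // k IH; rewrite derive1nS; exact: test_function_derive1.
Qed.

Lemma test_function_L2 phi : test_function phi -> is_L2 phi.
Proof.
move=> [dphi cphi].
have cp : continuous phi.
  by move=> x; apply/differentiable_continuous/derivable1_diffP; exact: (dphi 0%N).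
have mp : measurable_fun setT phi by exact: continuous_measurable_fun.
apply/L2P; split => //.
apply: (@integrable_support _ (closure [set x | phi x != 0])).
- exact: compact_measurable.
- move=> x xn; have [->|px] := eqVneq (phi x) 0; first by rewrite mulr0.
  by exfalso; apply: xn; exact: subset_closure.
- apply: continuous_compact_integrable => //; apply: continuous_subspaceT.
  by move=> x; apply: cvgM; exact: cp.
Qed.

(** The shape a f - g covers differences, with a = 1, as well as the error of a difference quotient
    in time. *)
Lemma is_weak_derivative_lin k a f g f' g' : is_L2 f -> is_L2 g -> is_L2 f' -> is_L2 g' ->
  is_weak_derivative k f f' -> is_weak_derivative k g g' ->
  is_weak_derivative k (fun x => a * f x - g x) (fun x => a * f' x - g' x).
Proof.
move=> Lf Lg Lf' Lg' ff gg phi tphi.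
have E (p q r : R -> R) : is_L2 p -> is_L2 q -> is_L2 r ->
    \int[mu]_x ((a * p x - q x) * r x) = a * \int[mu]_x (p x * r x) - \int[mu]_x (q x * r x).
  move=> Lp Lq Lr; have i1 := L2_mul_integrable Lp Lr; have i2 := L2_mul_integrable Lq Lr.
  rewrite -RintegralZl// -RintegralB//; last exact: integrable_scale.
  by apply: eq_Rintegral => x _; ring.
have Lk := test_function_L2 (test_function_derive1n k tphi).
rewrite !E//; last exact: test_function_L2.
rewrite ff// gg//; ring.
Qed.

Lemma sobolev_lin s a f g : sobolev s f -> sobolev s g -> sobolev s (fun x => a * f x - g x).
Proof.
move=> [Lf Hf] [Lg Hg]; split; first by apply: L2_sub => //; exact: L2_scale.
move=> k ks; have [f' Lf' ff'] := Hf k ks; have [g' Lg' gg'] := Hg k ks.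
exists (fun x => a * f' x - g' x); first by apply: L2_sub => //; exact: L2_scale.
exact: is_weak_derivative_lin.
Qed.

Lemma sobolev_le s s' f : (s' <= s)%N -> sobolev s f -> sobolev s' f.
Proof. by move=> ss [Lf Hf]; split => // k ks; apply: Hf; exact: leq_trans ss. Qed.

Lemma crep0_lin s a f g x : (0 < s)%N -> sobolev s f -> sobolev s g ->
  crep 0 (fun x => a * f x - g x) x = a * crep 0 f x - crep 0 g x.
Proof.
move=> s0 sf sg; have sh := sobolev_lin a sf sg.
suff -> : crep 0 (fun x => a * f x - g x) = (fun x => a * crep 0 f x - crep 0 g x) by [].
apply: ae_eq_continuous.
- exact: crep_continuous sh s0.
- move=> y; apply: cvgB; last exact: crep_continuous sg s0 y.
  by apply: cvgM; [exact: cvg_cst|exact: crep_continuous sf s0 y].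
- apply: ae_imply2 (ae_and (crep0_ae sf s0) (crep0_ae sg s0)) (crep0_ae sh s0) => y.
  by move=> [-> ->] ->.
Qed.

(** Weak derivatives are chosen, so linearity is not built in; it follows by differentiating the
    identity of order 0. *)
Lemma crep1_lin s a f g x : (1 < s)%N -> sobolev s f -> sobolev s g ->
  crep 1 (fun x => a * f x - g x) x = a * crep 1 f x - crep 1 g x.
Proof.
move=> s1 sf sg; have sh := sobolev_lin a sf sg; have s0 := ltnW s1.
have d1 := crep_is_derive x sh s1.
have E : crep 0 (fun x => a * f x - g x) = (fun x => a * crep 0 f x - crep 0 g x).
  by apply/funext => y; exact: crep0_lin s0 sf sg.
have d2 : is_derive x 1 (crep 0 (fun x => a * f x - g x)) (a *: crep 1 f x - crep 1 g x).
  rewrite E; apply: is_deriveB; last exact: crep_is_derive sg s1.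
  by apply: is_deriveZ; exact: crep_is_derive sf s1.
by have [_ <-] := d1; have [_ ->] := d2.
Qed.

Lemma sqnorm_sobolev_norm_le s f : (0 < s)%N -> sobolev s f ->
  sqnorm f <= sobolev_norm s f ^+ 2.
Proof.
move=> s0 sf; have [E LC P] := crepP sf s0.
have [L1 _] := sobolev_weak_derivative sf (leq0n s).
rewrite -(eq_ae_sqnorm LC sf.1 (crep0_ae sf s0)) (eq_ae_sqnorm LC L1 E).
exact: sqnorm_weak_derivative_le.
Qed.

Lemma sqnormD f g : is_L2 f -> is_L2 g ->
  sqnorm (fun x => f x + g x) = sqnorm f + 2 * \int[mu]_x (f x * g x) + sqnorm g.
Proof.
move=> Lf Lg.
have i1 := L2_mul_integrable Lf Lf; have i2 := L2_mul_integrable Lg Lg.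
have i3 := integrable_scale 2 measurableT (L2_mul_integrable Lf Lg).
rewrite /sqnorm -RintegralZl//; last exact: L2_mul_integrable.
rewrite -RintegralD// -RintegralD//; last exact: integrable_add.
by apply: eq_Rintegral => x _; ring.
Qed.

Lemma eq_sqnorm f g : f =1 g -> sqnorm f = sqnorm g.
Proof. by move=> fg; apply: eq_Rintegral => x _; rewrite fg. Qed.

(* |F| >= a / 2 on an interval of length a / (2 S) with end point z, on the
   left of z if F z > 0 and on its right otherwise. *)
Lemma one_sided_slope_le F G S a z : is_L2 F -> (forall x : R, is_derive x 1 F (G x)) ->
  (forall x, G x <= S) -> 0 < S -> 0 < a -> a <= `|F z| -> a ^+ 3 <= 8 * S * sqnorm F.
Proof.
move=> LF dF GS S0 a0 aF.
have cF := is_derive_continuous dF.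
have slope x y : x <= y -> F y - F x <= S * (y - x).
  move=> xy; have [c _ ->] := MVT_segment xy (fun t _ => dF t) (continuous_subspaceT cF).
  by rewrite ler_wpM2r ?GS// subr_ge0.
pose d := a / (2 * S).
have d0 : 0 < d by rewrite divr_gt0// mulr_gt0.
have Sd : S * d = a / 2 by rewrite /d; field; rewrite gt_eqF.
suff [p Hp] : exists p, forall t, `[p, p + d]%classic t -> (a / 2) ^+ 2 <= F t * F t.
  have pd : p <= p + d by rewrite lerDl ltW.
  have Fi : mu.-integrable `[p, p + d] (EFin \o (fun t => F t * F t)).
    by apply: integrableS (L2_mul_integrable LF LF).
  have h : \int[mu]_(t in `[p, p + d]) ((a / 2) ^+ 2) <= \int[mu]_(t in `[p, p + d]) (F t *
    F t).
    apply: le_Rintegral => //.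
    by apply: continuous_integrable_itv; exact: cst_continuous.
  rewrite Rintegral_itv_cst// addrC addKr in h.
  have h2 : \int[mu]_(t in `[p, p + d]) (F t * F t) <= sqnorm F.
    apply: Rintegral_le_setT => //; last exact: L2_mul_integrable.
    by move=> t; rewrite -expr2 sqr_ge0.
  have -> : a ^+ 3 = 8 * S * ((a / 2) ^+ 2 * d) by rewrite /d; field; rewrite gt_eqF.
  by rewrite ler_pM2l ?mulr_gt0//; exact: le_trans h h2.
have sq t : a / 2 <= `|F t| -> (a / 2) ^+ 2 <= F t * F t.
  move=> h; rewrite -expr2 -[X in _ <= X]ger0_norm ?sqr_ge0// normrX ler_pXn2r// ?nnegrE//.
  by rewrite divr_ge0 ?ltW.
(* An upper bound on the slope limits only how fast [F] rises: to the left of a high point [F] is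
   still high, to the right of a low point it is still low. *)
move: aF; rewrite ler_normr => /orP[aF|aF].
- exists (z - d) => t; rewrite subrK /= in_itv /= => /andP[h1 h2]; apply: sq.
  have := slope t z h2; rewrite ler_normr => h3; apply/orP; left.
  have : S * (z - t) <= a / 2 by rewrite -Sd ler_pM2l//; lra.
  lra.
- exists z => t; rewrite /= in_itv /= => /andP[h1 h2]; apply: sq.
  have := slope z t h1; rewrite ler_normr => h3; apply/orP; right.
  have : S * (t - z) <= a / 2 by rewrite -Sd ler_pM2l//; lra.
  lra.
Qed.

(** Outside a compact interval [F] stays below half of the positive value [F x0], so the maximum
    over the interval is global. *)
Lemma vanishing_max F x0 : continuous F -> vanishes_at_infinity F -> 0 < F x0 ->
  exists xm, forall x, F x <= F xm.
Proof.
move=> cF vF F0; have [M M0 HM] := vF (F x0 / 2) (ltac:(by rewrite divr_gt0)).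
have Mx : - (M + `|x0|) <= M + `|x0| by have := normr_ge0 x0; lra.
have [c cI Hc] := EVT_max Mx (continuous_subspaceT cF).
have x0c : F x0 <= F c by apply: Hc; rewrite in_itv /= -ler_norml; lra.
exists c => x; have [xM|xM] := leP `|x| (M + `|x0|).
  by apply: Hc; rewrite in_itv /= -ler_norml.
have : `|F x| <= F x0 / 2 by apply: HM; have := normr_ge0 x0; lra.
have := ler_norm (F x); lra.
Qed.

Lemma derive_at_global_max F x y : is_derive x 1 F y -> (forall t, F t <= F x) ->
  (forall t : R, derivable F t 1) -> y = 0.
Proof.
move=> dF Fx dd.
have d0 : is_derive x 1 F 0.
  apply: (@derive1_at_max _ F (x - 1) (x + 1)) => //; first lra.
  by rewrite in_itv /=; apply/andP; split; lra.
by have [_ <-] := dF; have [_ ->] := d0.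
Qed.

End LinearCombinations.

(** * Evolution of the energy and of the maximal slope *)

Section Evolution.
Context {R : realType}.
Notation mu := (@lebesgue_measure R).
Implicit Types (a c x y r t : R) (f g : R -> R) (s k : nat).

Lemma fun_sub1 f g : f \- g = (fun x => 1 * f x - g x).
Proof. by apply/funext => x; rewrite mul1r. Qed.

Lemma cvg_within_subset (A B : set R) (F : R -> R) t (l : R) : A `<=` B ->
  F r @[r --> within B (nbhs t)] --> l -> F r @[r --> within A (nbhs t)] --> l.
Proof.
move=> AB Fl P nP; have H : nbhs t (fun r => B r -> P (F r)) := Fl P nP.
suff : nbhs t (fun r => A r -> P (F r)) by [].
by apply: filterS H => r h /AB; exact: h.
Qed.

Lemma sobolev_sub s f g : sobolev s f -> sobolev s g -> sobolev s (f \- g).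
Proof. by move=> sf sg; rewrite fun_sub1; exact: sobolev_lin. Qed.

Lemma crep1_sub s f g x : (1 < s)%N -> sobolev s f -> sobolev s g ->
  crep 1 (f \- g) x = crep 1 f x - crep 1 g x.
Proof. by move=> s1 sf sg; rewrite fun_sub1 (crep1_lin _ _ s1)// mul1r. Qed.

Lemma time_interval_itv (T : \bar R) t1 : time_interval T t1 ->
  `[0, t1]%classic `<=` time_interval T.
Proof.
move=> [_ t1T] t; rewrite /= in_itv /= => /andP[t0 tt1]; split => //.
by apply: le_lt_trans t1T; rewrite lee_fin.
Qed.

Lemma time_interval_interior (T : \bar R) t : time_interval T t -> 0 < t ->
  (time_interval T)°%classic t.
Proof.
move=> [_ tT] t0; rewrite /interior.
have [t' tt' t'T] : exists2 t', t < t' & (t'%:E <= T)%E.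
  case: T tT => [T| |] //; first by rewrite lte_fin => tT; exists T.
  by move=> _; exists (t + 1); [rewrite ltrDl|rewrite leey].
have : \forall r \near t, - r < 0 /\ r < t'.
  by near=> r; split; near: r; [apply: Nlt_nbhsl; rewrite oppr_lt0|exact: lt_nbhsl].
apply: filterS => r [r0 rt']; split; first by rewrite -oppr_le0 ltW.
by apply: lt_le_trans t'T; rewrite lte_fin.
Unshelve. all: by end_near. Qed.

Lemma sup_range_dist f g (e : R) : has_sup (range f) -> has_sup (range g) ->
  (forall x, `|f x - g x| <= e) -> `|sup (range f) - sup (range g)| <= e.
Proof.
move=> hf hg fg.
have le_sup (h : R -> R) x : has_sup (range h) -> h x <= sup (range h).
  by move=> hh; apply: sup_upper_bound => //; exists x.
rewrite ler_norml; apply/andP; split.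
- rewrite lerBrDl addrC -lerBrDl opprK; apply: ge_sup; first by exists (g 0), 0.
  move=> _ [x _ <-]; have := fg x; have := le_sup f x hf;
    rewrite ler_norml => ? /andP[? ?]; lra.
- rewrite lerBlDr; apply: ge_sup; first by exists (f 0), 0.
  move=> _ [x _ <-]; have := fg x; have := le_sup g x hg;
    rewrite ler_norml => ? /andP[? ?]; lra.
Qed.

(** If |U| exceeded S^2 / 4 somewhere, the slope estimate would give S^6 / 64 <= 8 S E, that is S^5
    <= 512 E, hence S <= 512 E because the summand 1 forces S > 1. So U and both averages are at
    most S^2 / 4 in absolute value, and the slope of [g] at [xm] is at most - S^2 + S^2 / 2. *)
Lemma slope_at_max_decreases f g S xm : sobolev 3 f -> sobolev 2 g ->
  {ae mu, forall x, g x + f x * weak_derivative 1 f x +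
    convolution FW_kernel (weak_derivative 1 f) x = 0} ->
  1 + 512 * sqnorm f < S -> (forall x, crep 1 f x <= S) -> crep 1 f xm = S ->
  crep 1 g xm < 0.
Proof.
move=> sf sg eqn SE fS fxm.
have E0 := sqnorm_ge0 f.
have dW y : is_derive y 1 (crep 1 f) (crep 2 f y) by exact: crep_is_derive sf _.
have X0 : crep 2 f xm = 0.
  by apply: (derive_at_global_max (dW xm)) => y; [rewrite fxm|have [] := dW y].
have S1 : 1 < S by lra.
have S0 : 0 < S by lra.
have [_ LU _] := crepP sf (isT : (0 < 3)%N).
have Ubound y : `|crep 0 f y| <= S ^+ 2 / 4.
  rewrite leNgt; apply/negP => Uy.
  have dU (z : R) : is_derive z 1 (crep 0 f) (crep 1 f z) by exact: crep_is_derive sf _.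
  have a0 : 0 < S ^+ 2 / 4 by rewrite divr_gt0// exprn_gt0.
  have := one_sided_slope_le LU dU fS S0 a0 (ltW Uy).
  rewrite (eq_ae_sqnorm LU sf.1 (crep0_ae sf isT)) => h.
  have h5 : S * S ^+ 5 <= S * (512 * sqnorm f).
    have -> : S * S ^+ 5 = 64 * (S ^+ 2 / 4) ^+ 3 by field.
    have -> : S * (512 * sqnorm f) = 64 * (8 * S * sqnorm f) by ring.
    by rewrite ler_pM2l.
  rewrite ler_pM2l// in h5.
  have h6 : S <= S ^+ 5 by rewrite exprS ler_peMr ?exprn_ege1// ltW.
  lra.
have cU := crep_continuous sf (isT : (0 < 3)%N).
have hA := lexpavg_le cU Ubound (x := xm) (fun y _ => Ubound y).
have hB := rexpavg_le cU Ubound (x := xm) (fun y _ => Ubound y).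
have hU := Ubound xm.
rewrite (FW_derivative sf sg eqn) X0 mulr0 subr0 fxm.
have S2 : 0 < S ^+ 2 by rewrite exprn_gt0.
move: (crep 0 f xm) (lexpavg _ xm) (rexpavg _ xm) hU hA hB => U A B.
rewrite !ler_norml => /andP[? ?] /andP[? ?] /andP[? ?].
lra.
Qed.

Lemma sqnormD_le f g : is_L2 f -> is_L2 g ->
  sqnorm (fun x => f x + g x) <= 2 * sqnorm f + 2 * sqnorm g.
Proof.
move=> Lf Lg; have Lfg := L2_add Lf Lg.
have i1 := L2_mul_integrable Lf Lf; have i2 := L2_mul_integrable Lg Lg.
have i3 := integrable_scale 2 measurableT i1; have i4 := integrable_scale 2 measurableT i2.
rewrite /sqnorm -!RintegralZl// -RintegralD//; apply: le_Rintegral => //.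
- exact: L2_mul_integrable.
- exact: integrable_add.
- by move=> x _; have := sqr_ge0 (f x - g x); nra.
Qed.

(** Cauchy-Schwarz combined with ||f|| <= ||f||^2 + 1, which avoids square roots. *)
Lemma norm_Rintegral_mul_le f h (e : R) : is_L2 f -> is_L2 h -> 0 < e -> sqnorm h <= e ^+ 2 ->
  `|\int[mu]_x (f x * h x)| <= (sqnorm f + 1) * e.
Proof.
move=> Lf Lh e0 he; have E0 := sqnorm_ge0 f.
have E1e : 0 <= (sqnorm f + 1) * e by rewrite mulr_ge0 ?ltW//; lra.
rewrite -(ler_pXn2r (n := 2)) ?nnegrE// -normrX ger0_norm ?sqr_ge0//.
apply: le_trans (cauchy_schwarz Lf Lh) _.
apply: (@le_trans _ _ (sqnorm f * e ^+ 2)); first by rewrite ler_wpM2l.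
by rewrite exprMn ler_wpM2r ?sqr_ge0//; nra.
Qed.

Lemma sqnormD_dist_le f h (e : R) : is_L2 f -> is_L2 h -> 0 < e -> e <= 1 ->
  sqnorm h <= e ^+ 2 ->
  `|sqnorm (fun x => f x + h x) - sqnorm f| <= e * (2 * (sqnorm f + 1) + 1).
Proof.
move=> Lf Lh e0 e1 he.
have := norm_Rintegral_mul_le Lf Lh e0 he; rewrite sqnormD//.
have h0 := sqnorm_ge0 h.
have ee : e ^+ 2 <= e by rewrite expr2 ler_piMl// ltW.
move: (Rintegral _ _ _) => J; rewrite !ler_norml => /andP[? ?]; apply/andP; split; lra.
Qed.

(** To be read with f = u(t), g = u_t, c = r - t and [h] the error of the difference quotient, so
    that the perturbed function is u(r). Orthogonality removes the only term that is not small. *)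
Lemma sqnormD_quotient_le f g h c (e : R) : is_L2 f -> is_L2 g -> is_L2 h ->
  \int[mu]_x (f x * g x) = 0 -> c != 0 -> 0 < e -> e <= 1 -> sqnorm h <= e ^+ 2 ->
  `|(sqnorm (fun x => f x + c * (g x + h x)) - sqnorm f) / c| <=
  2 * (sqnorm f + 1) * e + `|c| * (2 * sqnorm g + 2).
Proof.
move=> Lf Lg Lh fg c0 e0 e1 he.
have Lgh := L2_add Lg Lh.
have i1 := L2_mul_integrable Lf Lg; have i2 := L2_mul_integrable Lf Lh.
have -> : sqnorm (fun x => f x + c * (g x + h x)) =
    sqnorm f + 2 * (c * \int[mu]_x (f x * h x)) + c ^+ 2 * sqnorm (fun x => g x + h x).
  rewrite sqnormD//; last exact: L2_scale.
  have -> : \int[mu]_x (f x * (c * (g x + h x))) = c * \int[mu]_x (f x * h x).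
    rewrite -[X in _ = c * X]add0r -fg -RintegralD// -RintegralZl//; last exact: integrable_add.
    by apply: eq_Rintegral => x _; ring.
  congr (_ + _); rewrite /sqnorm -RintegralZl//; last exact: L2_mul_integrable.
  by apply: eq_Rintegral => x _; ring.
have hJ := norm_Rintegral_mul_le Lf Lh e0 he.
have hN := sqnormD_le Lg Lh.
have N0 := sqnorm_ge0 (fun x => g x + h x).
have ee : e ^+ 2 <= 1 by rewrite exprn_ile1// ltW.
move: (Rintegral _ _ _) hJ => J hJ; set N := sqnorm (fun x => g x + h x) in hN N0 *.
have -> : (sqnorm f + 2 * (c * J) + c ^+ 2 * N - sqnorm f) / c = 2 * J + c * N by field.
rewrite (le_trans (ler_normD _ _))// lerD//.
  by rewrite normrM [`|2|]ger0_norm// -mulrA ler_wpM2l.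
rewrite normrM ler_wpM2l// ger0_norm//; lra.
Qed.

Lemma slope_constants a c : 0 <= a -> 0 <= c ->
  [/\ 2 * a <= 2 * a + (1 + 512 * c), 1 + 512 * c <= 2 * a + (1 + 512 * c) &
      0 < 2 * a + (1 + 512 * c)].
Proof. by move=> *; split; lra. Qed.

Lemma left_point_ex a d : 0 < a -> 0 < d -> exists r, [/\ r < a, 0 <= r & a - r < d].
Proof.
move=> a0 d0; exists (a - Num.min (d / 2) a).
have : 0 < Num.min (d / 2) a by rewrite lt_min divr_gt0.
have : Num.min (d / 2) a <= d / 2 by rewrite ge_min lexx.
have : Num.min (d / 2) a <= a by rewrite ge_min lexx orbT.
by move: (Num.min _ _) => p *; split; lra.
Qed.

(** * Energy and maximal slope along a solution *)

Section Solution.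
Variables (T : \bar R) (u v : R -> R -> R).
Let I := time_interval T.
Hypothesis (cu : sobolev_continuous I 3 u) (cv : sobolev_continuous I 2 v).
Hypothesis du : sobolev_derivative I 2 u v.
Hypothesis equation : forall t, (I°)%classic t -> {ae mu, forall x,
  v t x + u t x * weak_derivative 1 (u t) x + convolution FW_kernel (weak_derivative 1 (u
    t)) x = 0}.

Let su t : I t -> sobolev 3 (u t). Proof. by move=> /cu[]. Qed.
Let su2 t : I t -> sobolev 2 (u t). Proof. by move=> /su; exact: sobolev_le. Qed.
Let sv t : I t -> sobolev 2 (v t). Proof. by move=> /cv[]. Qed.

Let q t r x := (r - t)^-1 * (u r x - u t x) - v t x.

Let sq t r : I t -> I r -> sobolev 2 (q t r).
Proof. by move=> It Ir; apply: sobolev_lin; [apply: sobolev_sub; exact: su2|exact: sv]. Qed.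

(** Membership in [I] is recorded with the smallness: outside [I] the curve is unconstrained, and
    its Sobolev norm would carry no information. *)
Lemma quotient_vanishes t (e : R) : (I°)%classic t -> 0 < e ->
  \forall r \near t^', sobolev_norm 2 (q t r) <= e /\ I r.
Proof.
move=> It e0.
have h : \forall r \near within I t^', sobolev_norm 2 (q t r) <= e.
  have /cvgrPdist_le/(_ e e0) := du (interior_subset It).
  by apply: filterS => r; rewrite sub0r normrN ger0_norm ?sobolev_norm_ge0.
have It' : \forall r \near t^', I r.
  by apply: (nbhs_dnbhs (x := t)); exact: It.
rewrite near_withinE in h; near=> r; split; last by near: r.
suff : I r by near: r.
by near: r.
Unshelve. all: by end_near. Qed.

Lemma energy_is_derive t : (I°)%classic t -> is_derive t 1 (fun r => sqnorm (u r)) 0.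
Proof.
move=> It; have It0 := interior_subset It.
have orth := FW_orthogonal (su It0) (sv It0) (equation It).
set E := sqnorm (u t); have E0 : 0 <= E := sqnorm_ge0 _.
have V0 : 0 <= sqnorm (v t) := sqnorm_ge0 _.
apply/is_derive1_caratheodory.
exists (fun z => if z == t then 0 else (sqnorm (u z) - E) / (z - t)); split;
  last by rewrite eqxx.
  move=> z; case: eqVneq => [->|zt]; first by rewrite subrr mul0r.
  by rewrite divfK// subr_eq0.
have key r e : I r -> r != t -> 0 < e -> e <= 1 -> sobolev_norm 2 (q t r) <= e ->
    `|(sqnorm (u r) - E) / (r - t)| <= 2 * (E + 1) * e + `|r - t| * (2 * sqnorm (v t) + 2).
  move=> Ir rt e0 e1 qe; have rt0 : r - t != 0 by rewrite subr_eq0.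
  have sqr := sq It0 Ir.
  have qn : sqnorm (q t r) <= e ^+ 2.
    apply: le_trans (sqnorm_sobolev_norm_le (isT : (0 < 2)%N) sqr) _.
    by rewrite ler_pXn2r ?nnegrE ?sobolev_norm_ge0// ltW.
  rewrite (@eq_sqnorm _ (u r) (fun x => u t x + (r - t) * (v t x + q t r x))); last first.
    by move=> x; rewrite /q; field.
  exact: sqnormD_quotient_le (su It0).1 (sv It0).1 sqr.1 orth rt0 e0 e1 qn.
apply/cvgrPdist_le => /= e e0; rewrite eqxx.
(* The two terms of the bound in [key] receive e/2 each: [d] controls the first, the distance from
   [r] to [t] the second. *)
pose d := Num.min 1 (e / (4 * (E + 1))).
have E1 : 0 < E + 1 by lra.
have d0 : 0 < d by rewrite lt_min ltr01 divr_gt0// mulr_gt0.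
have d1 : d <= 1 by rewrite ge_min lexx.
have dE : 2 * (E + 1) * d <= e / 2.
  apply: (@le_trans _ _ (2 * (E + 1) * (e / (4 * (E + 1))))).
    by rewrite ler_wpM2l ?ge_min ?lexx ?orbT// mulr_ge0// ltW.
  by rewrite le_eqVlt; apply/orP; left; apply/eqP; field; rewrite gt_eqF.
have := quotient_vanishes It d0; rewrite near_withinE => near_q.
have V2 : 0 < 2 * sqnorm (v t) + 2 by lra.
near=> r.
have hr : r != t -> sobolev_norm 2 (q t r) <= d /\ I r by near: r.
have rt2 : `|r - t| <= e / 2 / (2 * sqnorm (v t) + 2).
  rewrite distrC; near: r; apply: cvgr_dist_le; first exact: cvg_id.
  by rewrite !divr_gt0.
rewrite sub0r normrN; case: eqVneq => [_|rt]; first by rewrite normr0 ltW.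
have [h1 h2] := hr rt.
apply: le_trans (key r d h2 rt d0 d1 h1) _.
rewrite ler_pdivlMr// in rt2; lra.
Unshelve. all: by end_near. Qed.

Lemma energy_continuous t : I t -> sqnorm (u r) @[r --> within I (nbhs t)] --> sqnorm (u t).
Proof.
move=> It; set E := sqnorm (u t); have E0 : 0 <= E := sqnorm_ge0 _.
have [_ cut] := cu It.
have Lu := (su It).1.
apply/cvgrPdist_le => e e0.
pose d := Num.min 1 (e / (2 * (E + 1) + 1)).
have E2 : 0 < 2 * (E + 1) + 1 by lra.
have d0 : 0 < d by rewrite lt_min ltr01 divr_gt0.
have d1 : d <= 1 by rewrite ge_min lexx.
have dE : d * (2 * (E + 1) + 1) <= e by rewrite -ler_pdivlMr// ge_min lexx orbT.
have h : \forall r \near within I (nbhs t), sobolev_norm 3 (u r \- u t) <= d.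
  have /cvgrPdist_le/(_ d d0) := cut.
  by apply: filterS => r; rewrite sub0r normrN ger0_norm ?sobolev_norm_ge0.
have hI : \forall r \near within I (nbhs t), I r by rewrite near_withinE; near=> r.
near=> r.
have Ir : I r by near: r.
have sd : sobolev 3 (u r \- u t) by apply: sobolev_sub; exact: su.
have hd : sobolev_norm 3 (u r \- u t) <= d by near: r.
have Ld := sd.1.
have dn : sqnorm (u r \- u t) <= d ^+ 2.
  apply: le_trans (sqnorm_sobolev_norm_le (isT : (0 < 3)%N) sd) _.
  by rewrite ler_pXn2r ?nnegrE ?sobolev_norm_ge0// ltW.
rewrite distrC (@eq_sqnorm _ (u r) (fun x => u t x + (u r \- u t) x)); last first.
  by move=> x /=; ring.
exact: le_trans (sqnormD_dist_le Lu Ld d0 d1 dn) dE.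
Unshelve. all: by end_near. Qed.

(** The equation gives the derivative at interior times only; continuity up to time 0 lets the mean
    value theorem reach the initial value. *)
Lemma energy_conserved t : I t -> sqnorm (u t) = sqnorm (u 0).
Proof.
move=> It; have [t0 _] := It; move: t0; rewrite le_eqVlt => /predU1P[<-//|t0].
have IS := time_interval_itv It.
have cE : {within `[0, t], continuous (fun r => sqnorm (u r))}.
  apply/subspace_continuousP => r /IS Ir.
  exact: cvg_within_subset IS (energy_continuous Ir).
have [|c _] := @MVT _ (fun r => sqnorm (u r)) (fun=> 0) 0 t t0 _ cE; last first.
  by rewrite mul0r => /eqP; rewrite subr_eq0 => /eqP.
move=> r; rewrite in_itv /= => /andP[r0 rt].
apply: energy_is_derive; apply: time_interval_interior => //.
by apply: IS; rewrite /= in_itv /= !ltW.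
Qed.

Let W t := crep 1 (u t).

Let m t := sup [set W t x | x in setT].

Let W_has_sup t : I t -> has_sup [set W t x | x in setT].
Proof.
move=> It; split; first by exists (W t 0), 0.
exists (2 * sobolev_norm 3 (u t)) => _ [x _ <-].
by rewrite (le_trans (ler_norm _))// (crep_sup _ (su It)).
Qed.

Let W_le_m t x : I t -> W t x <= m t.
Proof. by move=> It; apply: sup_upper_bound; [exact: W_has_sup|exists x]. Qed.

Let m_le t c : (forall x, W t x <= c) -> m t <= c.
Proof. by move=> Wc; apply: ge_sup; [exists (W t 0), 0|move=> _ [x _ <-]]. Qed.

(** A supremum moves by at most the uniform distance of the functions, and [crep_sup] bounds that
    distance of the slopes by twice the H^3 distance. *)
Lemma max_slope_continuous t : I t -> m r @[r --> within I (nbhs t)] --> m t.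
Proof.
move=> It; have [_ cut] := cu It.
apply/cvgrPdist_le => e e0; have e2 : 0 < e / 2 by rewrite divr_gt0.
have h : \forall r \near within I (nbhs t), sobolev_norm 3 (u r \- u t) <= e / 2.
  have /cvgrPdist_le/(_ _ e2) := cut.
  by apply: filterS => r; rewrite sub0r normrN ger0_norm ?sobolev_norm_ge0.
have hI : \forall r \near within I (nbhs t), I r by rewrite near_withinE; near=> r.
near=> r.
have Ir : I r by near: r.
have sd : sobolev 3 (u r \- u t) by apply: sobolev_sub; exact: su.
have hd : sobolev_norm 3 (u r \- u t) <= e / 2 by near: r.
rewrite distrC; apply: sup_range_dist; [exact: W_has_sup|exact: W_has_sup|move=> x].
rewrite -(crep1_sub x (isT : (1 < 3)%N) (su Ir) (su It)).
apply: le_trans (crep_sup x sd (isT : (1 < 3)%N)) _.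
by rewrite mulrC -ler_pdivlMr.
Unshelve. all: by end_near. Qed.

(** The first summand dominates all slopes at time 0, so an excess can only be attained at a
    positive time; the second is the threshold of [slope_at_max_decreases]. *)
Lemma slope_bound t x : I t ->
  crep 1 (u t) x <= 2 * sobolev_norm 3 (u 0) + (1 + 512 * sqnorm (u 0)).
Proof.
move=> It; set K := _ + _; rewrite leNgt; apply/negP => Wtx.
have [KN KE K0] := slope_constants (sobolev_norm_ge0 3 (u 0)) (sqnorm_ge0 (u 0)).
rewrite -/K in KN KE K0.
have IS := time_interval_itv It.
have t0 : 0 <= t by case: It.
have I0 : I 0 by apply: IS; rewrite /= in_itv /= lexx.
have cm : {within `[0, t], continuous m}.
  apply/subspace_continuousP => r /IS Ir.
  exact: cvg_within_subset IS (max_slope_continuous Ir).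
have [tm tmI tmax] := EVT_max t0 cm.
have Itm : I tm by apply: IS.
have S_ge r y : r \in `[0, t] -> W r y <= m tm.
  by move=> rI; apply: le_trans (tmax r rI); apply: W_le_m; exact: IS.
have SK : K < m tm.
  by apply: lt_le_trans Wtx _; apply: S_ge; rewrite in_itv /= t0 lexx.
have [x0 Wx0] : exists x0, 0 < W tm x0.
  apply: contrapT => /forallNP H.
  have : m tm <= 0 by apply: m_le => y; rewrite leNgt; apply/negP; exact: H.
  by rewrite leNgt (lt_trans K0 SK).
have sm := su Itm.
(* A positive supremum is attained, because [W tm] vanishes at infinity. *)
have [xm xmax] : exists xm, forall y, W tm y <= W tm xm.
  apply: (vanishing_max (crep_continuous sm (isT : (1 < 3)%N)) _ Wx0).
  by move=> e e0; apply: (crep_vanish sm (isT : (1 < 3)%N)).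
have WS : W tm xm = m tm by apply/eqP; rewrite eq_le W_le_m//= m_le.
have tm0 : 0 < tm.
  move: (tmI); rewrite in_itv /= => /andP[+ _]; rewrite le_eqVlt => /predU1P[tm0|//].
  have : W 0 xm <= K.
    by rewrite (le_trans (ler_norm _))// (le_trans (crep_sup _ (su I0) _)).
  by rewrite tm0 WS leNgt SK.
have Iotm := time_interval_interior Itm tm0.
have Yneg : crep 1 (v tm) xm < 0.
  apply: (slope_at_max_decreases sm (sv Itm) (equation Iotm) _ (fun y => S_ge tm y tmI) WS).
  by rewrite (energy_conserved Itm) (le_lt_trans KE).
move: Yneg; rewrite ltNge => /negP; apply.
(* The opposite sign comes from the past: the slope of [v tm] at [xm] is at least - e for every e >
   0. The tolerance e/2 makes up for the factor 2 in [crep_sup]. *)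
apply/ler_addgt0Pl => e e0.
have e2 : 0 < e / 2 by rewrite divr_gt0.
have := quotient_vanishes Iotm e2; rewrite near_withinE => -[d /= d0 Hd].
have [r [rtm r0 rd]] := left_point_ex tm0 d0.
have [||hq Ir] := Hd r.
- by rewrite /ball_ /= gtr0_norm ?subr_gt0.
- by rewrite lt_eqF.
have rI : r \in `[0, t].
  move: tmI; rewrite !in_itv /= => /andP[_ tmt].
  by rewrite r0 (le_trans (ltW rtm)).
have sqr := sq Itm Ir.
have := crep_sup xm sqr (isT : (1 < 2)%N).
rewrite /q (crep1_lin _ _ (isT : (1 < 2)%N) (sobolev_sub (su2 Ir) (su2 Itm)) (sv Itm)).
rewrite (crep1_sub _ (isT : (1 < 2)%N) (su2 Ir) (su2 Itm)).
(* Both factors are nonpositive: [r] precedes [tm], and no slope at time [r] exceeds the maximum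
   over space and time. *)
have p0 : 0 <= (r - tm)^-1 * (crep 1 (u r) xm - crep 1 (u tm) xm).
  rewrite -mulrNN mulr_ge0//.
    by rewrite oppr_ge0 invr_le0 subr_le0 ltW.
  by rewrite opprB subr_ge0 -/(W tm) -/(W r) WS S_ge.
rewrite -/(q tm r) => h; apply: le_trans p0 _; rewrite -lerBlDr.
apply: le_trans (ler_norm _) (le_trans h _).
by rewrite mulrC -ler_pdivlMr.
Qed.

End Solution.
End Evolution.

Theorem proposition3p9 (R : realType) (u0 : R -> R) (T : \bar R)
    (u : R -> R -> R) :
  sobolev 3 u0 ->
  (0 < T)%E ->
  T = life_span u0 ->
  strong_solution (time_interval T) u0 u ->
  (ereal_sup
    [set ereal_sup
       [set (continuous_representative (weak_derivative 1 (u t)) x)%:E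
       | x in [set: R]]
    | t in time_interval T] < +oo)%E.
Proof.
move=> _ _ _ [cu _ [v [cv du equation]]].
set K := 2 * sobolev_norm 3 (u 0) + (1 + 512 * sqnorm (u 0)).
apply: (@le_lt_trans _ _ K%:E); last exact: ltry.
apply: ge_ereal_sup => _ [t It <-].
apply: ge_ereal_sup => _ [x _ <-]; rewrite lee_fin.
exact: (slope_bound cu cv du equation).
Qed.
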